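(* Let $\mathcal{A},\mathcal{B}$ be unital $^*$-algebras over $\mathsf{C}$ with $^*$-actions of a Hopf $^*$-algebra $H$ such that $\mathsf{Pic}^{\mathrm{str}}(\mathcal{B},\mathcal{A})\neq\emptyset$. Consider the map $\mathsf{Pic}^{\mathrm{str}}_H(\mathcal{B},\mathcal{A})\to\mathsf{Pic}^{\mathrm{str}}(\mathcal{B},\mathcal{A})$ forgetting the $H$-action. Then one has the following alternatives: (i) $\mathsf{Pic}^{\mathrm{str}}_H(\mathcal{B},\mathcal{A})=\emptyset$; or (ii) $\mathsf{Pic}^{\mathrm{str}}_H(\mathcal{B},\mathcal{A})\to\mathrm{im}\subseteq\mathsf{Pic}^{\mathrm{str}}(\mathcal{B},\mathcal{A})$ is a principal $\mathrm{U}_0(H,\mathcal{B})$-bundle over its image, i.e. the group $\mathrm{U}_0(H,\mathcal{B})$ acts freely and transitively from the left on each fiber of the map over its image, the action being $[\mathsf{b}]\cdot[\mathcal{E},\triangleright]=[\mathcal{E},\triangleright^{\mathsf{b}}]$ with $g\triangleright^{\mathsf{b}}x=\mathsf{b}(g_{(1)})\cdot(g_{(2)}\triangleright x)$.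
   Context: **Ground ring.** $\mathsf{R}$ is an ordered ring (commutative, unital), $\mathsf{C}=\mathsf{R}(i)$ with $i^2=-1$, with complex conjugation. A $^*$-algebra over $\mathsf{C}$ is an associative $\mathsf{C}$-algebra with a $\mathsf{C}$-antilinear involutive antiautomorphism. Modules over unital algebras are unital and carry a compatible $\mathsf{C}$-module structure. **Hopf $^*$-algebra.** $H$ is a Hopf algebra over $\mathsf{C}$ ($\Delta(g)=g_{(1)}\otimes g_{(2)}$, counit $\epsilon$, antipode $S$) which is also a $^*$-algebra such that $\Delta,\epsilon$ are $^*$-homomorphisms and $S(S(g)^* )^*=g$. A $^*$-action of $H$ on a unital $\mathcal{A}$ is a left $H$-module structure with $1_H\triangleright a=a$, $g\triangleright(ab)=(g_{(1)}\triangleright a)(g_{(2)}\triangleright b)$, $(g\triangleright a)^*=S(g)^*\triangleright a^*$, $g\triangleright1=\epsilon(g)1$. **Inner products.** $\omega:\mathcal{A}\to\mathsf{C}$ linear is positive if $\omega(a^*a)\ge0$; $a$ is positive if $\omega(a)\ge0$ for all positive $\omega$. An $\mathcal{A}$-valued inner product on a right $\mathcal{A}$-module is $\mathsf{C}$-sesquilinear (linear in the second argument) with $\langle x,y\cdot a\rangle=\langle x,y\rangle a$, $\langle x,y\rangle=\langle y,x\rangle^*$ (on left modules: left linear in the first argument). It is non-degenerate if $\langle x,\cdot\rangle=0$ implies $x=0$, full if its values span the algebra, completely positive if $(\langle x_i,x_j\rangle)$ is positive in $M_n$ of the algebra for all $n$, $x_1,\dots,x_n$. **Equivalence bimodules.**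 A strong (Morita) equivalence bimodule is a $(\mathcal{B},\mathcal{A})$-bimodule $\mathcal{E}$ with full, non-degenerate, completely positive inner products ${}_{\mathcal{B}}\langle\cdot,\cdot\rangle$ (left $\mathcal{B}$-linear) and $\langle\cdot,\cdot\rangle_{\mathcal{A}}$ (right $\mathcal{A}$-linear) with $\langle b\cdot x,y\rangle_{\mathcal{A}}=\langle x,b^*\cdot y\rangle_{\mathcal{A}}$, ${}_{\mathcal{B}}\langle x\cdot a,y\rangle={}_{\mathcal{B}}\langle x,y\cdot a^*\rangle$, ${}_{\mathcal{B}}\langle x,y\rangle\cdot z=x\cdot\langle y,z\rangle_{\mathcal{A}}$. It is $H$-covariant if it carries an $H$-module structure $\triangleright$ with $g\triangleright\langle x,y\rangle_{\mathcal{A}}=\langle S(g_{(1)})^*\triangleright x,g_{(2)}\triangleright y\rangle_{\mathcal{A}}$ and $g\triangleright{}_{\mathcal{B}}\langle x,y\rangle={}_{\mathcal{B}}\langle g_{(1)}\triangleright x,S(g_{(2)})^*\triangleright y\rangle$. $\mathsf{Pic}^{\mathrm{str}}(\mathcal{B},\mathcal{A})$ is the set of isomorphism classes of strong equivalence bimodules (isomorphisms: bimodule isomorphisms preserving both inner products); $\mathsf{Pic}^{\mathrm{str}}_H(\mathcal{B},\mathcal{A})$ is the set of isomorphism classes $[\mathcal{E},\triangleright]$ of $H$-covariant ones (isomorphisms additionally $H$-equivariant). **The group $\mathrm{U}_0(H,\mathcal{B})$.** $\mathrm{U}(H,\mathcal{B})$ is the set of $\mathsf{b}\in\mathrm{Hom}_{\mathsf{C}}(H,\mathcal{B})$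 such that for all $g,h\in H$, $b\in\mathcal{B}$: $\mathsf{b}(1_H)=1$; $\mathsf{b}(gh)=\mathsf{b}(g_{(1)})(g_{(2)}\triangleright\mathsf{b}(h))$; $(g_{(1)}\triangleright b)\mathsf{b}(g_{(2)})=\mathsf{b}(g_{(1)})(g_{(2)}\triangleright b)$; $\mathsf{b}(g_{(1)})\left(\mathsf{b}(S(g_{(2)})^* )\right)^*=\epsilon(g)1$. It is a group under convolution $(\mathsf{a}*\mathsf{b})(g)=\mathsf{a}(g_{(1)})\mathsf{b}(g_{(2)})$. For $c$ in the group $\mathrm{U}(\mathcal{Z}(\mathcal{B}))$ of unitary central elements, $\hat c(g)=c\,(g\triangleright c^{-1})$ defines a central element of $\mathrm{U}(H,\mathcal{B})$, and $\mathrm{U}_0(H,\mathcal{B})=\mathrm{U}(H,\mathcal{B})/\widehat{\mathrm{U}(\mathcal{Z}(\mathcal{B}))}$. *)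

(* Defs.v *)
From HB Require Import structures.
From mathcomp Require Import all_boot all_order all_algebra.
From mathcomp Require Import generic_quotient boolp.
From mathcomp Require Import complex.

Set Implicit Arguments.
Unset Strict Implicit.
Unset Printing Implicit Defensive.

Import GRing.Theory.
Local Open Scope ring_scope.
Local Open Scope quotient_scope.

(* The library makes R[i] a ring only over a field, whereas R is merely an
   ordered ring: cplx R is a copy of R[i] carrying the same operations. *)
Definition cplx (R : realDomainType) : Type := R[i].

Section CplxRing.
Variable R : realDomainType.

HB.instance Definition _ := GRing.Zmodule.copy (cplx R) R[i].

Fact cplx_mul1 : left_id (Complex 1 0 : cplx R) (@ComplexField.mulc R).
Proof. by case=> a b /=; rewrite !mul1r !mul0r subr0 addr0. Qed.

Fact cplx_mulD : left_distributive (@ComplexField.mulc R) (@ComplexField.addc R).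
Proof.
case=> [a b] [c d] [e f] /=; rewrite !mulrDl !opprD -!addrA.
by congr Complex; congr (_ + _); apply: addrCA.
Qed.

Fact cplx_1neq0 : (Complex 1 0 : cplx R) != 0.
Proof. by rewrite eq_complex /= oner_eq0. Qed.

HB.instance Definition _ := GRing.Zmodule_isComNzRing.Build (cplx R)
  (@ComplexField.mulcA R) (@ComplexField.mulcC R) cplx_mul1 cplx_mulD
  cplx_1neq0.

Definition cconj (z : cplx R) : cplx R := conjc z.

Definition cnonneg (z : cplx R) : bool :=
  (complex.Im z == 0) && (0 <= complex.Re z).

Lemma cconjD : {morph cconj : x y / x + y}.
Proof. by case=> a b [c d]; rewrite /cconj /= opprD. Qed.

Lemma cconjM : {morph cconj : x y / x * y}.
Proof.
case=> a b [c d]; rewrite /cconj /GRing.mul /= !mulrN !mulNr opprK opprD.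
by [].
Qed.

Lemma cconjK : involutive cconj.
Proof. by case=> a b; rewrite /cconj /= opprK. Qed.

Lemma cconj1 : cconj 1 = 1.
Proof. by rewrite /cconj /GRing.one /= oppr0. Qed.

End CplxRing.

Section Tensor.
Variables (C : comNzRingType) (U V : lmodType C).

Definition balanced (M : zmodType) (f : U -> V -> M) : Prop :=
  [/\ forall u u' v, f (u + u') v = f u v + f u' v,
      forall u v v', f u (v + v') = f u v + f u v'
    & forall c u v, f (c *: u) v = f u (c *: v)].

(* A list of pairs stands for the sum of the corresponding pure tensors. *)
Definition eval_sum (M : zmodType) (f : U -> V -> M) (s : seq (U * V)) : M :=
  \sum_(p <- s) f p.1 p.2.

(* Equality in U (x) V, by its universal property among abelian groups; this
   covers bilinear as well as conjugate-bilinear maps. *)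
Definition tensor_eq (s t : seq (U * V)) : Prop :=
  forall (M : zmodType) (f : U -> V -> M),
    balanced f -> eval_sum f s = eval_sum f t.

Definition tensor_eqb (s t : seq (U * V)) : bool := `[< tensor_eq s t >].

Lemma tensor_eqb_refl : reflexive tensor_eqb.
Proof. by move=> s; apply/asboolP. Qed.

Lemma tensor_eqb_sym : symmetric tensor_eqb.
Proof. by move=> s t; apply: asbool_equiv_eq; split=> e M f bf; rewrite e. Qed.

Lemma tensor_eqb_trans : transitive tensor_eqb.
Proof.
move=> s t u /asboolP e /asboolP e'; apply/asboolP => M f bf.
by rewrite e ?e'.
Qed.

Canonical tensor_equiv := EquivRel tensor_eqb
  tensor_eqb_refl tensor_eqb_sym tensor_eqb_trans.

Definition tensor := {eq_quot tensor_equiv}.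
HB.instance Definition _ := Choice.on tensor.
HB.instance Definition _ := Quotient.on tensor.

Implicit Types (s t : seq (U * V)) (x y z : tensor).

Lemma tensor_eqP s t :
  reflect (s = t %[mod {eq_quot tensor_equiv}]) (tensor_eqb s t).
Proof. exact: eqmodP. Qed.

Definition tensor_class s : tensor := \pi_({eq_quot tensor_equiv}) s.

Lemma tensor_classP s t : tensor_eq s t -> tensor_class s = tensor_class t.
Proof. by move=> e; apply/tensor_eqP/asboolP. Qed.

Lemma tensor_reprP s : tensor_eq (repr (tensor_class s)) s.
Proof. by apply/asboolP/tensor_eqP; rewrite reprK. Qed.

Lemma tensor_reprK x : tensor_class (repr x) = x.
Proof. exact: reprK. Qed.

Definition tens (u : U) (v : V) : tensor := tensor_class [:: (u, v)].

(* The additive map with u (x) v |-> f u v; meaningful only for balanced f. *)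
Definition tlift (M : zmodType) (f : U -> V -> M) (x : tensor) : M :=
  eval_sum f (repr x).

Definition sum_scale (c : C) s := [seq (c *: p.1, p.2) | p <- s].

Definition tensor_add x y := tensor_class (repr x ++ repr y).
Definition tensor_scale c x := tensor_class (sum_scale c (repr x)).
Definition tensor_opp := tensor_scale (-1).
Definition tensor_zero := tensor_class [::].

Section Eval.
Variables (M : zmodType) (f : U -> V -> M).

Lemma eval_cat s t : eval_sum f (s ++ t) = eval_sum f s + eval_sum f t.
Proof. exact: big_cat. Qed.

Hypothesis bf : balanced f.

Lemma balanced_scale c : balanced (fun u v => f (c *: u) v).
Proof.
have [fl fr fZ] := bf; split=> [u u' v|u v v'|d u v].
- by rewrite scalerDr fl.
- exact: fr.
- by rewrite -fZ !scalerA mulrC.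
Qed.

Lemma balanced0 v : f 0 v = 0.
Proof.
have [fl _ _] := bf; have /eqP := fl 0 0 v.
by rewrite addr0 -subr_eq0 opprD addrA subrr add0r oppr_eq0 => /eqP.
Qed.

Lemma tlift_class s : tlift f (tensor_class s) = eval_sum f s.
Proof. exact: tensor_reprP. Qed.

Lemma tliftE u v : tlift f (tens u v) = f u v.
Proof. by rewrite tlift_class /eval_sum big_seq1. Qed.

End Eval.

Lemma eval_scale (M : zmodType) (f : U -> V -> M) c s :
  eval_sum f (sum_scale c s) = eval_sum (fun u v => f (c *: u) v) s.
Proof. by rewrite /eval_sum big_map. Qed.

Ltac tsolve := let M := fresh "M" in let f := fresh "f" in let bf := fresh "bf" in
  apply: tensor_classP => M f bf;
  rewrite ?(eval_cat, eval_scale, tensor_reprP _ bf)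
    ?(tensor_reprP _ (balanced_scale bf _)) ?(eval_cat, eval_scale).

Fact tensor_addA : associative tensor_add.
Proof. by move=> x y z; tsolve; rewrite addrA. Qed.

Fact tensor_addC : commutative tensor_add.
Proof. by move=> x y; tsolve; rewrite addrC. Qed.

Fact tensor_add0 : left_id tensor_zero tensor_add.
Proof.
move=> x; rewrite -[RHS]tensor_reprK; tsolve.
by rewrite /eval_sum big_nil add0r.
Qed.

Fact tensor_addN : left_inverse tensor_zero tensor_opp tensor_add.
Proof.
move=> x; tsolve; rewrite /eval_sum big_nil -big_split big1 // => p _ /=.
have [fl _ _] := bf.
by rewrite scaleN1r -fl addNr (balanced0 bf).
Qed.

HB.instance Definition _ :=
  GRing.isZmodule.Build tensor tensor_addA tensor_addC tensor_add0 tensor_addN.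

Fact tensor_scaleA c d x :
  tensor_scale c (tensor_scale d x) = tensor_scale (c * d) x.
Proof. by tsolve; apply: eq_bigr => p _; rewrite scalerA mulrC. Qed.

Fact tensor_scale1 : left_id 1 tensor_scale.
Proof.
move=> x; rewrite -[RHS]tensor_reprK; tsolve.
by apply: eq_bigr => p _; rewrite scale1r.
Qed.

Fact tensor_scaleDr : right_distributive tensor_scale +%R.
Proof. by move=> c x y; tsolve. Qed.

Fact tensor_scaleDl x : {morph tensor_scale^~ x : c d / c + d}.
Proof.
move=> c d; tsolve; rewrite /eval_sum -big_split /=; apply: eq_bigr => p _.
by have [fl _ _] := bf; rewrite scalerDl fl.
Qed.

HB.instance Definition _ := GRing.Zmodule_isLmodule.Build C tensor
  tensor_scaleA tensor_scale1 tensor_scaleDr tensor_scaleDl.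

Lemma tliftD (M : zmodType) (f : U -> V -> M) :
  balanced f -> {morph tlift f : x y / x + y}.
Proof.
by move=> bf x y; rewrite -[x + y]/(tensor_add x y) tlift_class // eval_cat.
Qed.

Lemma tliftZ (M : lmodType C) (f : U -> V -> M) (g : M -> M) c :
  balanced f -> {morph g : x y / x + y} ->
  (forall u v, f (c *: u) v = g (f u v)) ->
  forall x, tlift f (c *: x) = g (tlift f x).
Proof.
move=> bf gD fZ x; rewrite -[c *: x]/(tensor_scale c x) tlift_class // eval_scale.
have g0 : g 0 = 0.
  have /eqP := gD 0 0.
  by rewrite addr0 -subr_eq0 opprD addrA subrr add0r oppr_eq0 => /eqP.
rewrite /tlift /eval_sum (big_morph g gD g0).
by apply: eq_bigr => p _; rewrite fZ.
Qed.

Lemma balanced_tens : balanced tens.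
Proof.
have H s t : tensor_class (s ++ t) = tensor_class s + tensor_class t.
  by apply: tensor_classP => M f bf; rewrite !eval_cat !tensor_reprP.
split=> [u u' v|u v v'|c u v]; rewrite /tens -?H; apply: tensor_classP => M f.
all: case=> fl fr fZ; rewrite /eval_sum /= !big_cons !big_nil !addr0 /=.
all: by rewrite ?fl ?fr ?fZ.
Qed.

Lemma tensZl c u v : tens (c *: u) v = c *: tens u v.
Proof.
rewrite -[RHS]/(tensor_scale c _); tsolve.
by rewrite /eval_sum /= !big_seq1.
Qed.

Lemma tensor_sum x : x = \sum_(p <- repr x) tens p.1 p.2.
Proof.
rewrite -[LHS]tensor_reprK; elim: (repr x) => [|[u v] s IHs].
  by rewrite big_nil.
rewrite big_cons -IHs; apply: tensor_classP => M f bf.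
by rewrite eval_cat !tensor_reprP // -eval_cat.
Qed.

End Tensor.

(* algType is not used for *-algebras because it excludes the zero algebra. *)
HB.mixin Record isStarAlgebra (R : realDomainType) A
    of GRing.Lmodule (cplx R) A := {
  amul : A -> A -> A;
  aone : A;
  amulA : forall a b c, amul a (amul b c) = amul (amul a b) c;
  amul1l : forall a, amul aone a = a;
  amul1r : forall a, amul a aone = a;
  amul_linl : forall b, linear (amul^~ b);
  amul_linr : forall a, linear (amul a);
  star : A -> A;
  starD : forall a b, star (a + b) = star a + star b;
  starZ : forall (c : cplx R) a, star (c *: a) = cconj c *: star a;
  starM : forall a b, star (amul a b) = amul (star b) (star a);
  starK : forall a, star (star a) = a }.

#[short(type="starAlgType")]
HB.structure Definition StarAlgebra (R : realDomainType) :=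
  { A of isStarAlgebra R A & GRing.Lmodule (cplx R) A }.

Declare Scope star_scope.
Delimit Scope star_scope with star.
Local Open Scope star_scope.
Notation "a · b" := (amul a b) (at level 40, left associativity) : star_scope.
Notation "a ^⋆" := (star a) (at level 1, format "a ^⋆") : star_scope.
Notation "u '⊗' v" := (tens u v) (at level 39, left associativity) : star_scope.

HB.mixin Record hasComul (R : realDomainType) H of GRing.Lmodule (cplx R) H := {
  comul : {linear H -> tensor H H} }.

#[short(type="comulType")]
HB.structure Definition Comul (R : realDomainType) :=
  { H of hasComul R H & GRing.Lmodule (cplx R) H }.

(* \sw_(a, b <- g) E is the sum of E over g_(1) (x) g_(2) = a (x) b, for an E
   that is balanced in a and b. *)
Definition sweedler (R : realDomainType) (H : comulType R) (M : zmodType)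
  (g : H) (f : H -> H -> M) : M := tlift f (comul g).

Notation "'\sw_' ( a , b '<-' g ) E" := (sweedler g (fun a b => E))
  (at level 41, a name, b name, g at level 50, E at level 41,
   right associativity, format "'\sw_' ( a ,  b  '<-'  g )  E") : star_scope.

HB.mixin Record isHopfStar (R : realDomainType) H
    of StarAlgebra R H & Comul R H := {
  counit : {scalar H};
  antipode : {linear H -> H};
  (* (H (x) H) (x) H is identified with H (x) (H (x) H) *)
  comulA : forall g : H,
    \sw_(a, b <- g) \sw_(a1, a2 <- a) (a1 ⊗ (a2 ⊗ b))
    = \sw_(a, b <- g) (a ⊗ comul b);
  counitl : forall g : H, \sw_(a, b <- g) (counit a *: b) = g;
  counitr : forall g : H, \sw_(a, b <- g) (counit b *: a) = g;
  comul1 : comul (aone : H) = (aone : H) ⊗ (aone : H);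
  comulM : forall g h : H,
    comul (g · h) = \sw_(a, b <- g) \sw_(c, d <- h) ((a · c) ⊗ (b · d));
  counit1 : counit (aone : H) = 1;
  counitM : forall g h : H, counit (g · h) = counit g * counit h;
  antipodel : forall g : H, \sw_(a, b <- g) (antipode a · b) = counit g *: aone;
  antipoder : forall g : H, \sw_(a, b <- g) (a · antipode b) = counit g *: aone;
  comul_star : forall g : H, comul g^⋆ = \sw_(a, b <- g) (a^⋆ ⊗ b^⋆);
  counit_star : forall g : H, counit g^⋆ = cconj (counit g);
  antipode_star : forall g : H, (antipode ((antipode g)^⋆))^⋆ = g }.

#[short(type="hopfStarType")]
HB.structure Definition HopfStar (R : realDomainType) :=
  { H of isHopfStar R H & StarAlgebra R H & Comul R H }.

HB.mixin Record isHStarAlgebra (R : realDomainType) (H : hopfStarType R) A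
    of StarAlgebra R A := {
  hact : H -> A -> A;
  hact_linl : forall a, linear (hact^~ a);
  hact_linr : forall g, linear (hact g);
  hactM : forall g h a, hact (g · h) a = hact g (hact h a);
  hact1l : forall a, hact (aone : H) a = a;
  hact_mul : forall g a b,
    hact g (a · b) = \sw_(g1, g2 <- g) (hact g1 a · hact g2 b);
  hact_star : forall g a, (hact g a)^⋆ = hact (antipode g)^⋆ a^⋆;
  hact1r : forall g, hact g aone = counit g *: aone }.

#[short(type="hStarAlgType")]
HB.structure Definition HStarAlgebra (R : realDomainType) (H : hopfStarType R) :=
  { A of isHStarAlgebra R H A & StarAlgebra R A }.

Notation "g ▷ a" := (hact g a) (at level 38, right associativity) : star_scope.

Section Slin.
Variable R : realDomainType.
Local Notation C := (cplx R).
Implicit Types (U V W : lmodType C) (A : starAlgType R).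

(* linear (s = false) or antilinear (s = true) *)
Definition slin U V (s : bool) (f : U -> V) : Prop :=
  forall (c : C) x y, f (c *: x + y) = (if s then cconj c else c) *: f x + f y.

Definition bilin U V W (f : U -> V -> W) : Prop :=
  (forall v, slin false (f^~ v)) /\ (forall u, slin false (f u)).

Lemma slin_D U V s (f : U -> V) : slin s f -> {morph f : x y / x + y}.
Proof.
move=> lf x y; have := lf 1 x y; rewrite scale1r => ->.
by case: s {lf}; rewrite ?cconj1 scale1r.
Qed.

Lemma slin_0 U V s (f : U -> V) : slin s f -> f 0 = 0.
Proof.
move=> lf; have := slin_D lf 0 0; rewrite addr0 => /eqP.
by rewrite -subr_eq0 opprD addrA subrr add0r oppr_eq0 => /eqP.
Qed.

Lemma slin_Z U V s (f : U -> V) c x :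
  slin s f -> f (c *: x) = (if s then cconj c else c) *: f x.
Proof. by move=> lf; rewrite -[c *: x]addr0 lf (slin_0 lf) addr0. Qed.

Lemma slin_sum U V s (f : U -> V) I (r : seq I) F :
  slin s f -> f (\sum_(i <- r) F i) = \sum_(i <- r) f (F i).
Proof. by move=> lf; apply: (big_morph f (slin_D lf) (slin_0 lf)). Qed.

Lemma bilin_balanced U V W (f : U -> V -> W) : bilin f -> balanced f.
Proof.
case=> fl fr; split=> [u u' v|u v v'|c u v].
- exact: slin_D (fl v) u u'.
- exact: slin_D (fr u) v v'.
- by rewrite (slin_Z c u (fl v)) (slin_Z c v (fr u)).
Qed.

Lemma tlift_slin U V W (f : U -> V -> W) : bilin f -> slin false (tlift f).
Proof.
move=> bf c x y; rewrite tliftD; last exact: bilin_balanced.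
congr (_ + _); apply: (tliftZ (g := fun w => c *: w)).
- exact: bilin_balanced.
- exact: scalerDr.
- by move=> u v; rewrite (slin_Z c u (bf.1 v)).
Qed.

Lemma slin_linear U V (f : {linear U -> V}) : slin false f.
Proof. exact: linearP. Qed.

Lemma slin_id U : slin false (fun x : U => x).
Proof. by []. Qed.

Lemma slin_app U V W s t (h : V -> W) (f : U -> V) :
  slin t h -> slin s f -> slin (s (+) t) (fun x => h (f x)).
Proof.
by move=> lh lf c x y; rewrite lf lh; case: s {lf}; case: t {lh}; rewrite ?cconjK.
Qed.

Lemma slin_star U A s (f : U -> A) :
  slin (~~ s) f -> slin s (fun x => (f x)^⋆).
Proof.
by move=> lf c x y; rewrite lf starD starZ; case: s {lf}; rewrite ?cconjK.
Qed.

Lemma slin_mull U A s (f : U -> A) b : slin s f -> slin s (fun x => f x · b).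
Proof. by move=> lf c x y; rewrite lf amul_linl. Qed.

Lemma slin_mulr U A s (f : U -> A) a : slin s f -> slin s (fun x => a · f x).
Proof. by move=> lf c x y; rewrite lf amul_linr. Qed.

Lemma slin_scalel U V s (f : U -> C^o) (v : V) :
  slin s f -> slin s (fun x => (f x : C) *: v).
Proof. by move=> lf c x y; rewrite lf scalerDl -scalerA. Qed.

Lemma slin_scaler U V s (f : U -> V) (a : C) :
  slin s f -> slin s (fun x => a *: f x).
Proof. by move=> lf c x y; rewrite lf scalerDr !scalerA mulrC. Qed.

Lemma bilin_tens U V : bilin (@tens C U V).
Proof.
have [tl tr tZ] := @balanced_tens C U V.
by split=> [v|u] c x y; rewrite ?tl ?tr -?tZ tensZl.
Qed.

Lemma slin_tensl U V W s (f : U -> V) (w : W) :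
  slin s f -> slin s (fun x => f x ⊗ w).
Proof. by move=> lf c x y; rewrite lf (bilin_tens _ _).1. Qed.

Lemma slin_tensr U V W s (f : U -> V) (w : W) :
  slin s f -> slin s (fun x => w ⊗ f x).
Proof. by move=> lf c x y; rewrite lf (bilin_tens _ _).2. Qed.

Lemma slin_tlift U V W (X : lmodType C) s (F : X -> U -> V -> W) t :
  (forall u v, slin s (fun x => F x u v)) -> slin s (fun x => tlift (F x) t).
Proof.
move=> lF c x y; rewrite /tlift /eval_sum scaler_sumr -big_split /=.
by apply: eq_bigr => p _; rewrite lF.
Qed.

End Slin.

Section SlinH.
Variables (R : realDomainType) (H : hopfStarType R).
Local Notation C := (cplx R).
Implicit Types (U V W : lmodType C) (A : hStarAlgType H).

Lemma slin_sw U W s (F : U -> H -> H -> W) (g : H) :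
  (forall a b, slin s (fun x => F x a b)) ->
  slin s (fun x => sweedler g (F x)).
Proof. exact: slin_tlift. Qed.

Lemma slin_swg W (F : H -> H -> W) :
  bilin F -> slin false (fun g : H => sweedler g F).
Proof. by move=> bF c x y; rewrite /sweedler linearP tlift_slin. Qed.

Lemma slin_counit : slin false (counit : H -> C^o).
Proof. exact: linearP. Qed.

Lemma slin_counitZ U V s (f : U -> H) (v : V) :
  slin s f -> slin s (fun x => counit (f x) *: v).
Proof.
move=> lf c x y; rewrite lf linearP /= scalerDl -scalerA.
by [].
Qed.

Lemma slin_hactl U A s (f : U -> H) (a : A) :
  slin s f -> slin s (fun x => f x ▷ a).
Proof. by move=> lf c x y; rewrite lf hact_linl. Qed.

Lemma slin_hactr U A s (f : U -> A) (g : H) :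
  slin s f -> slin s (fun x => g ▷ f x).
Proof. by move=> lf c x y; rewrite lf hact_linr. Qed.

End SlinH.

(* Proves slin and bilin goals by following the shape of the function. *)
Ltac lin :=
  repeat (cbv beta; match goal with
  | h : bilin ?F |- bilin ?F => exact h
  | |- bilin _ => split; [intro | intro]
  | |- forall _, _ => intro
  | |- slin _ (fun x => x) => exact (@slin_id _ _)
  | h : slin ?s ?f |- slin ?s ?f => exact h
  | |- slin ?s (fun x => (@?f x)^⋆) => refine (@slin_star _ _ _ s f _); unfold negb
  | |- slin ?s (fun x => (@?f x) · ?b) => refine (@slin_mull _ _ _ s f b _)
  | |- slin ?s (fun x => ?a · (@?f x)) => refine (@slin_mulr _ _ _ s f a _)
  | |- slin ?s (fun x => (@?f x) ▷ ?b) => refine (@slin_hactl _ _ _ _ s f b _)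
  | |- slin ?s (fun x => ?a ▷ (@?f x)) => refine (@slin_hactr _ _ _ _ s f a _)
  | |- slin ?s (fun x => (@?f x) ⊗ ?b) => refine (@slin_tensl _ _ _ _ s f b _)
  | |- slin ?s (fun x => ?a ⊗ (@?f x)) => refine (@slin_tensr _ _ _ _ s f a _)
  | |- slin ?s (fun x => ?a *: (@?f x)) => refine (@slin_scaler _ _ _ s f a _)
  | |- slin ?s (fun x => sweedler ?g (@?F x)) => refine (@slin_sw _ _ _ _ s F g _)
  | |- slin false (fun x => sweedler x ?F) => refine (@slin_swg _ _ _ F _)
  | |- slin ?s (fun x => sweedler (@?f x) ?F) =>
      refine (@slin_app _ _ _ _ s false (fun g => sweedler g F) f _ _)
  | |- slin ?s (fun x => tlift ?F (@?f x)) =>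
      refine (@slin_app _ _ _ _ s false (tlift F) f (tlift_slin _) _)
  | |- slin ?s (fun x => @GRing.Linear.sort _ _ _ _ _ (@?f x) *: ?v) =>
      refine (@slin_counitZ _ _ _ _ s f v _)
  | |- slin false (@GRing.Linear.sort _ _ _ _ ?L) => exact (slin_linear L)
  | |- slin ?s (fun x => @GRing.Linear.sort _ _ _ _ ?L (@?f x)) =>
      refine (@slin_app _ _ _ _ s false L f (slin_linear L) _)
  | h : slin ?t ?b |- slin ?s (fun x => ?b (@?f x)) =>
      refine (@slin_app _ _ _ _ s t b f h _)
  | h : bilin ?F |- slin ?s (fun x => ?F (@?f x) ?v) =>
      refine (@slin_app _ _ _ _ s false (F^~ v) f (h.1 v) _)
  | h : bilin ?F |- slin ?s (fun x => ?F ?v (@?f x)) =>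
      refine (@slin_app _ _ _ _ s false (F v) f (h.2 v) _)
  | h : forall u v, slin false (fun x => ?F x u v)
      |- slin ?s (fun x => ?F (@?f x) ?v ?w) =>
      refine (@slin_app _ _ _ _ s false (fun x => F x v w) f (h v w) _)
  | h : forall u v, slin false (fun x => ?F u x v)
      |- slin ?s (fun x => ?F ?v (@?f x) ?w) =>
      refine (@slin_app _ _ _ _ s false (fun x => F v x w) f (h v w) _)
  | h : forall u v, slin false (fun x => ?F u v x)
      |- slin ?s (fun x => ?F ?v ?w (@?f x)) =>
      refine (@slin_app _ _ _ _ s false (fun x => F v w x) f (h v w) _)
  | h : forall u v w, slin false (fun x => ?F x u v w)
      |- slin ?s (fun x => ?F (@?f x) ?a1 ?a2 ?a3) =>
      refine (@slin_app _ _ _ _ s false (fun x => F x a1 a2 a3) f (h a1 a2 a3) _)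
  | h : forall u v w, slin false (fun x => ?F u x v w)
      |- slin ?s (fun x => ?F ?a1 (@?f x) ?a2 ?a3) =>
      refine (@slin_app _ _ _ _ s false (fun x => F a1 x a2 a3) f (h a1 a2 a3) _)
  | h : forall u v w, slin false (fun x => ?F u v x w)
      |- slin ?s (fun x => ?F ?a1 ?a2 (@?f x) ?a3) =>
      refine (@slin_app _ _ _ _ s false (fun x => F a1 a2 x a3) f (h a1 a2 a3) _)
  | h : forall u v w, slin false (fun x => ?F u v w x)
      |- slin ?s (fun x => ?F ?a1 ?a2 ?a3 (@?f x)) =>
      refine (@slin_app _ _ _ _ s false (fun x => F a1 a2 a3 x) f (h a1 a2 a3) _)
  end).

Section SwCalc.
Variables (R : realDomainType) (H : hopfStarType R).
Local Notation C := (cplx R).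
Implicit Types (V W : lmodType C) (A : hStarAlgType H) (g h : H).

Lemma eq_sw (W : zmodType) g (F G : H -> H -> W) :
  (forall a b, F a b = G a b) -> sweedler g F = sweedler g G.
Proof.
by move=> e; congr (sweedler g _); apply/funext => a; apply/funext => b.
Qed.

Lemma sw_app V W g (F : H -> H -> V) (L : V -> W) s :
  slin s L -> L (sweedler g F) = \sw_(a, b <- g) L (F a b).
Proof. by move=> lL; rewrite /sweedler /tlift /eval_sum (slin_sum _ _ lL). Qed.

Lemma counit_sw g (F : H -> H -> H) :
  counit (sweedler g F) = sweedler g (fun a b => counit (F a b)) :> C.
Proof. by rewrite /sweedler /tlift /eval_sum raddf_sum. Qed.

Lemma tlift_sw (V1 V2 : lmodType C) W g (F : H -> H -> tensor V1 V2)
    (L : V1 -> V2 -> W) :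
  bilin L -> tlift L (sweedler g F) = \sw_(a, b <- g) tlift L (F a b).
Proof. by move=> bL; apply: (sw_app _ _ (tlift_slin bL)). Qed.

Lemma tlift_tens (V1 V2 : lmodType C) W (L : V1 -> V2 -> W) a b :
  bilin L -> tlift L (a ⊗ b) = L a b.
Proof. by move=> bL; apply: tliftE; apply: bilin_balanced. Qed.

Lemma sw_tlift W g (F : H -> H -> W) : sweedler g F = tlift F (comul g).
Proof. by []. Qed.

Lemma sw_assoc W g (F : H -> H -> H -> W) :
  (forall u v, slin false (fun x => F x u v)) ->
  (forall u v, slin false (fun x => F u x v)) ->
  (forall u v, slin false (fun x => F u v x)) ->
  \sw_(p, c <- g) \sw_(a, b <- p) F a b c
  = \sw_(a, p <- g) \sw_(b, c <- p) F a b c.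
Proof.
move=> F1 F2 F3.
pose L (a : H) (t : tensor H H) := tlift (F a) t.
have bL : bilin L.
  split=> [t|a]; first by apply: slin_tlift => u v; apply: F1.
  by apply: tlift_slin; split=> *; lin.
have := congr1 (tlift L) (comulA g).
rewrite !tlift_sw // => e.
transitivity (\sw_(a, b <- g) tlift L (\sw_(a1, a2 <- a) (a1 ⊗ (a2 ⊗ b)))).
  apply: eq_sw => a b; rewrite tlift_sw //; apply: eq_sw => a1 a2.
  by rewrite tlift_tens // /L tlift_tens //; lin.
rewrite e; apply: eq_sw => a b; rewrite tlift_tens //.
Qed.

Lemma sw_counitl W (f : H -> W) g :
  slin false f -> \sw_(a, b <- g) (counit a *: f b) = f g.
Proof.
move=> lf; rewrite -[in RHS](counitl g) (sw_app _ _ lf).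
by apply: eq_sw => a b; rewrite (slin_Z _ _ lf).
Qed.

Lemma sw_counitr W (f : H -> W) g :
  slin false f -> \sw_(a, b <- g) (counit b *: f a) = f g.
Proof.
move=> lf; rewrite -[in RHS](counitr g) (sw_app _ _ lf).
by apply: eq_sw => a b; rewrite (slin_Z _ _ lf).
Qed.

Lemma sw_one W (F : H -> H -> W) : bilin F -> sweedler aone F = F aone aone.
Proof. by move=> bF; rewrite sw_tlift comul1 tlift_tens. Qed.

Lemma sw_mul W (F : H -> H -> W) g h : bilin F ->
  sweedler (g · h) F = \sw_(a, b <- g) \sw_(c, d <- h) F (a · c) (b · d).
Proof.
move=> bF; rewrite sw_tlift comulM tlift_sw //; apply: eq_sw => a b.
by rewrite tlift_sw //; apply: eq_sw => c d; rewrite tlift_tens.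
Qed.

Lemma sw_exch (W : zmodType) (F : H -> H -> H -> H -> W) g h :
  \sw_(a, b <- g) \sw_(c, d <- h) F a b c d
  = \sw_(c, d <- h) \sw_(a, b <- g) F a b c d.
Proof. exact: exchange_big. Qed.

Lemma sw_antipodel W (L : H -> W) g : slin false L ->
  \sw_(a, b <- g) L (antipode a · b) = counit g *: L aone.
Proof. by move=> lL; rewrite -(sw_app _ _ lL) antipodel (slin_Z _ _ lL). Qed.

Lemma sw_antipoder W (L : H -> W) g : slin false L ->
  \sw_(a, b <- g) L (a · antipode b) = counit g *: L aone.
Proof. by move=> lL; rewrite -(sw_app _ _ lL) antipoder (slin_Z _ _ lL). Qed.

Lemma sw_star W (F : H -> H -> W) g : bilin F ->
  sweedler g^⋆ F = \sw_(a, b <- g) F a^⋆ b^⋆.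
Proof.
move=> bF; rewrite sw_tlift comul_star tlift_sw //.
by apply: eq_sw => a b; rewrite tlift_tens.
Qed.

Lemma amul_swl (A : starAlgType R) g (F : H -> H -> A) x :
  sweedler g F · x = \sw_(a, b <- g) (F a b · x).
Proof. by rewrite (sw_app (L := fun y => y · x) _ _ (s := false)); last by lin. Qed.

Lemma amul_swr (A : starAlgType R) g (F : H -> H -> A) x :
  x · sweedler g F = \sw_(a, b <- g) (x · F a b).
Proof. by rewrite (sw_app (L := fun y => x · y) _ _ (s := false)); last by lin. Qed.

Lemma star_sw (A : starAlgType R) g (F : H -> H -> A) :
  (sweedler g F)^⋆ = \sw_(a, b <- g) (F a b)^⋆.
Proof. by rewrite (sw_app (L := fun y => y^⋆) _ _ (s := true)); last by lin. Qed.

Lemma hact_sw A g (F : H -> H -> A) h :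
  h ▷ sweedler g F = \sw_(a, b <- g) (h ▷ F a b).
Proof. by rewrite (sw_app (L := fun y => h ▷ y) _ _ (s := false)); last by lin. Qed.

Lemma scale_sw W g (F : H -> H -> W) (c : C) :
  c *: sweedler g F = \sw_(a, b <- g) (c *: F a b).
Proof. by rewrite (sw_app (L := fun y => c *: y) _ _ (s := false)); last by lin. Qed.

Lemma sw_mid W (F : H -> H -> H -> H -> W) g :
  (forall u v w, slin false (fun x => F x u v w)) ->
  (forall u v w, slin false (fun x => F u x v w)) ->
  (forall u v w, slin false (fun x => F u v x w)) ->
  (forall u v w, slin false (fun x => F u v w x)) ->
  \sw_(g1, g2 <- g) \sw_(p, q <- g1) \sw_(r, s <- g2) F p q r s
  = \sw_(p, t <- g) \sw_(w, s <- t) \sw_(q, r <- w) F p q r s.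
Proof.
move=> F1 F2 F3 F4; rewrite sw_assoc; try by lin.
apply: eq_sw => p t; rewrite [RHS]sw_assoc; by lin.
Qed.

End SwCalc.
Arguments sw_counitl {R H W} f {g}.
Arguments sw_counitr {R H W} f {g}.

Section Antipode.
Variables (R : realDomainType) (H : hopfStarType R).
Local Notation C := (cplx R).
Local Notation S := antipode.
Implicit Types (V W : lmodType C) (g h : H).

Lemma amulZl (A : starAlgType R) (c : C) (a b : A) : (c *: a) · b = c *: (a · b).
Proof. exact: (slin_Z c a (s := false) (f := amul^~ b) (amul_linl b)). Qed.

Lemma amulZr (A : starAlgType R) (c : C) (a b : A) : a · (c *: b) = c *: (a · b).
Proof. exact: (slin_Z c b (s := false) (f := amul a) (amul_linr a)). Qed.

Lemma star1 (A : starAlgType R) : (aone : A)^⋆ = aone.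
Proof. by rewrite -[LHS]amul1l -{1}(starK aone) -starM amul1l starK. Qed.

Lemma antipode1 : S (aone : H) = aone.
Proof.
have := antipodel (aone : H); rewrite counit1 scale1r => e; rewrite -[RHS]e.
rewrite (sw_one (F := fun a b => S a · b)); last first.
  by lin.
by rewrite amul1r.
Qed.

Lemma counit_antipode g : counit (S g) = counit g :> C.
Proof.
have e : \sw_(a, b <- g) (counit a *: S b) = S g.
  by rewrite (sw_counitl (W := H) (fun x => S x)); last by lin.
have := congr1 (fun x : H => counit x : C) (antipoder g).
rewrite counit_sw linearZ /= counit1 mulr1 => <-; rewrite -e counit_sw.
by apply: eq_sw => a b; rewrite linearZ /= counitM.
Qed.

Lemma sw_antipode W (F : H -> H -> W) g : bilin F ->
  sweedler (S g) F = \sw_(a, b <- g) F (S b) (S a).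
Proof.
move=> bF.
pose E := \sw_(a, p <- g) \sw_(u, q <- p) \sw_(c, d <- q)
  \sw_(x, y <- S a · u) F (x · S d) (y · S c).
transitivity E.
  symmetry; rewrite /E.
  rewrite -[RHS](sw_counitr (fun a => sweedler (S a) F)); last by lin.
  apply: eq_sw => a p.
  transitivity (\sw_(u, q <- p) \sw_(u1, u2 <- u) \sw_(c, d <- q)
     \sw_(x, y <- S a) F (x · u1 · S d) (y · u2 · S c)).
    apply: eq_sw => u q; rewrite [RHS]sw_exch; apply: eq_sw => c d.
    by rewrite sw_mul; [rewrite sw_exch | lin].
  rewrite sw_assoc; try by lin.
  transitivity (\sw_(u1, q <- p) \sw_(x, y <- S a) F (x · (u1 · S q)) y); last first.
    by rewrite (sw_antipoder (L := fun h => \sw_(x, y <- S a) F (x · h) y));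
      [congr (_ *: _); apply: eq_sw => x y; rewrite amul1r | lin].
  apply: eq_sw => u1 q.
  transitivity (\sw_(t, d <- q) \sw_(u2, c <- t) \sw_(x, y <- S a)
     F (x · u1 · S d) (y · (u2 · S c))).
    by rewrite sw_assoc; try (by lin); do 3!apply: eq_sw => ? ?; rewrite !amulA.
  transitivity (\sw_(t, d <- q) counit t *: \sw_(x, y <- S a) F (x · u1 · S d) y).
    apply: eq_sw => t d.
    rewrite (sw_antipoder
      (L := fun h => \sw_(x, y <- S a) F (x · u1 · S d) (y · h))); last by lin.
    by congr (_ *: _); apply: eq_sw => x y; rewrite amul1r.
  rewrite (sw_counitl (fun d => \sw_(x, y <- S a) F (x · u1 · S d) y)); last by lin.
  by apply: eq_sw => x y; rewrite amulA.
rewrite /E -sw_assoc; try by lin.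
rewrite -[RHS](sw_counitl (fun q => \sw_(c, d <- q) F (S d) (S c))); last by lin.
apply: eq_sw => r q.
rewrite (sw_antipodel (L := fun h =>
  \sw_(c, d <- q) \sw_(x, y <- h) F (x · S d) (y · S c))); last by lin.
congr (_ *: _); apply: eq_sw => c d.
by rewrite sw_one ?amul1l //; lin.
Qed.

(* convolution inverses in Hom (H (x) H, A) *)
Lemma conv2_uniq (A : starAlgType R) (F G K : H -> H -> A) :
  bilin F -> bilin G -> bilin K ->
  (forall g h, \sw_(a, b <- g) \sw_(c, d <- h) (G a c · F b d)
     = (counit g * counit h) *: aone) ->
  (forall g h, \sw_(a, b <- g) \sw_(c, d <- h) (F a c · K b d)
     = (counit g * counit h) *: aone) ->
  forall g h, G g h = K g h.
Proof.
move=> bF bG bK GF FK g h.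
pose E := \sw_(a, p <- g) \sw_(b, q <- p) \sw_(c, p' <- h) \sw_(d, q' <- p')
   (G a c · F b d · K q q').
transitivity E.
  rewrite /E.
  rewrite -[LHS](sw_counitr (fun g => G g h)); last by lin.
  apply: eq_sw => a p; rewrite sw_exch.
  rewrite -[X in _ *: X](sw_counitr (fun h => G a h)); last by lin.
  rewrite (sw_app (L := fun x => counit p *: x) _ _ (s := false)); last by lin.
  apply: eq_sw => c p'.
  transitivity (G a c · \sw_(a0, b <- p) \sw_(a1, b0 <- p') (F a0 a1 · K b b0)).
    by rewrite FK amulZr amul1r scalerA.
  rewrite (sw_app (L := fun x => G a c · x) _ _ (s := false)); last by lin.
  apply: eq_sw => b q.
  rewrite (sw_app (L := fun x => G a c · x) _ _ (s := false)); last by lin.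
  by apply: eq_sw => d q'; rewrite amulA.
rewrite /E -sw_assoc; try by lin.
transitivity (\sw_(r, q <- g) \sw_(r', q' <- h)
   (\sw_(a, b <- r) \sw_(c, d <- r') (G a c · F b d)) · K q q').
  apply: eq_sw => r q.
  transitivity (\sw_(a, b <- r) \sw_(r', q' <- h) \sw_(c, d <- r')
     (G a c · F b d · K q q')).
    by apply: eq_sw => a b; rewrite [RHS]sw_assoc; lin.
  rewrite sw_exch; apply: eq_sw => r' q'.
  rewrite [RHS](sw_app (L := fun x => x · K q q') _ _ (s := false)); last by lin.
  apply: eq_sw => a b.
  by rewrite [RHS](sw_app (L := fun x => x · K q q') _ _ (s := false)); last by lin.
rewrite -[RHS](sw_counitl (fun g => K g h)); last by lin.
apply: eq_sw => r q.
rewrite -[X in _ = _ *: X](sw_counitl (fun h => K q h)); last by lin.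
rewrite [RHS](sw_app (L := fun x => counit r *: x) _ _ (s := false)); last by lin.
by apply: eq_sw => r' q'; rewrite GF amulZl amul1l scalerA.
Qed.

End Antipode.

Section Convolution.
Variables (R : realDomainType) (H : hopfStarType R) (B : hStarAlgType H).
Implicit Types (a b : H -> B) (g h : H) (x : B).

Definition conv a b g : B := \sw_(g1, g2 <- g) (a g1 · b g2).

Definition conv_one g : B := counit g *: aone.

Definition conv_inv b g : B := (b (antipode g)^⋆)^⋆.

Record inU b : Prop := {
  U_lin : linear b;
  U_one : b aone = aone;
  U_mul : forall g h, b (g · h) = \sw_(g1, g2 <- g) (b g1 · (g2 ▷ b h));
  U_comm : forall g x,
    \sw_(g1, g2 <- g) ((g1 ▷ x) · b g2) = \sw_(g1, g2 <- g) (b g1 · (g2 ▷ x));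
  U_star : forall g,
    \sw_(g1, g2 <- g) (b g1 · (b (antipode g2)^⋆)^⋆) = counit g *: aone }.

Lemma conv_lin a b : slin false a -> slin false b -> slin false (conv a b).
Proof. by move=> la lb; rewrite /conv; lin. Qed.

Lemma conv_one_lin : slin false conv_one.
Proof. by rewrite /conv_one; lin. Qed.

Lemma conv_inv_lin b : slin false b -> slin false (conv_inv b).
Proof. by move=> lb; rewrite /conv_inv; lin. Qed.

Lemma convA a b c : slin false a -> slin false b -> slin false c ->
  conv a (conv b c) = conv (conv a b) c.
Proof.
move=> la lb lc; apply/funext => g; rewrite /conv.
transitivity (\sw_(g1, t <- g) \sw_(g2, g3 <- t) (a g1 · b g2 · c g3)).
  by do 2![apply: eq_sw => ? ?; rewrite ?amul_swr ?amulA].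
rewrite -sw_assoc; try by lin.
by apply: eq_sw => w g3; rewrite amul_swl.
Qed.

Lemma conv1l b : slin false b -> conv conv_one b = b.
Proof.
move=> lb; apply/funext => g; rewrite /conv /conv_one -[RHS](sw_counitl b) //.
by apply: eq_sw => g1 g2; rewrite amulZl amul1l.
Qed.

Lemma conv1r b : slin false b -> conv b conv_one = b.
Proof.
move=> lb; apply/funext => g; rewrite /conv /conv_one -[RHS](sw_counitr b) //.
by apply: eq_sw => g1 g2; rewrite amulZr amul1r.
Qed.

Lemma conv_invK b : conv_inv (conv_inv b) = b.
Proof. by apply/funext => g; rewrite /conv_inv starK antipode_star. Qed.

Lemma conv_inv_conv a b : slin false a -> slin false b ->
  conv_inv (conv a b) = conv (conv_inv b) (conv_inv a).
Proof.
move=> la lb; apply/funext => g; rewrite /conv_inv /conv sw_star; last by lin.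
rewrite star_sw sw_antipode; last by lin.
by apply: eq_sw => g1 g2; rewrite starM.
Qed.

Lemma hact_aoneZ g c : g ▷ (c *: aone : B) = (c * counit g) *: aone.
Proof. by rewrite (slin_Z c aone (slin_hactr g (slin_id (U := B)))) hact1r scalerA. Qed.

Lemma inU_conv_inv b : inU b -> conv b (conv_inv b) = conv_one.
Proof. by move=> Ub; apply/funext => g; apply: U_star Ub g. Qed.

Lemma conv_inv_one : conv_inv conv_one = conv_one.
Proof.
apply/funext => g; rewrite /conv_inv /conv_one starZ star1.
by rewrite counit_star cconjK counit_antipode.
Qed.

Lemma inU_one : inU conv_one.
Proof.
have l1 := conv_one_lin.
split=> [|||g x|g].
- exact: l1.
- by rewrite /conv_one counit1 scale1r.
- move=> g h; rewrite /conv_one counitM mulrC -scalerA.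
  rewrite -[LHS](sw_counitl (fun k => counit h *: (counit k *: aone))); last by lin.
  by apply: eq_sw => a b; rewrite hact_aoneZ amulZl amul1l scalerA.
- transitivity (g ▷ x).
    rewrite -[RHS](sw_counitr (fun y => y ▷ x)); last by lin.
    by apply: eq_sw => a b; rewrite amulZr amul1r.
  rewrite -[LHS](sw_counitl (fun y => y ▷ x)); last by lin.
  by apply: eq_sw => a b; rewrite amulZl amul1l.
- rewrite -[LHS]/(conv conv_one (conv_inv conv_one) g).
  by rewrite conv_inv_one conv1l.
Qed.

Lemma U_comm2 b w x y : inU b ->
  \sw_(q, r <- w) (y · (q ▷ x) · b r) = \sw_(q, r <- w) (y · b q · (r ▷ x)).
Proof.
move=> Ub; transitivity (y · \sw_(q, r <- w) ((q ▷ x) · b r)).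
  by rewrite amul_swr; apply: eq_sw => q r; rewrite amulA.
by rewrite (U_comm Ub) amul_swr; apply: eq_sw => q r; rewrite amulA.
Qed.

Lemma U_comm3 b w x y z : inU b ->
  \sw_(q, r <- w) (y · (q ▷ x) · b r · z)
  = \sw_(q, r <- w) (y · b q · (r ▷ x) · z).
Proof. by move=> Ub; rewrite -!amul_swl U_comm2. Qed.

Lemma inU_conv a b : inU a -> inU b -> inU (conv a b).
Proof.
move=> Ua Ub; have la : slin false a := U_lin Ua; have lb : slin false b := U_lin Ub.
split=> [||g h|g x|g].
- exact: conv_lin.
- by rewrite /conv sw_one ?(U_one Ua) ?(U_one Ub) ?amul1l //; lin.
- rewrite /conv sw_mul; last by lin.
  transitivity (\sw_(h1, h2 <- h) \sw_(g1, g2 <- g)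
     \sw_(p, q <- g1) \sw_(r, s <- g2)
     (a p · (q ▷ a h1) · b r · (s ▷ b h2))).
    rewrite [RHS]sw_exch; apply: eq_sw => g1 g2; apply: eq_sw => h1 h2.
    rewrite (U_mul Ua) (U_mul Ub) amul_swl; apply: eq_sw => p q.
    by rewrite amul_swr; apply: eq_sw => r s; rewrite !amulA.
  under [in RHS]eq_sw => g1 g2 do rewrite hact_sw amul_swr.
  rewrite [RHS]sw_exch; apply: eq_sw => h1 h2.
  rewrite sw_mid; try by lin.
  transitivity (\sw_(p, t <- g) \sw_(q, u <- t) (a p · b q · (u ▷ (a h1 · b h2)))).
    apply: eq_sw => p t.
    transitivity (\sw_(w, s <- t) \sw_(q, r <- w)
       (a p · b q · (r ▷ a h1) · (s ▷ b h2))).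
      apply: eq_sw => w s.
      exact: U_comm3.
    rewrite sw_assoc; try by lin.
    apply: eq_sw => q u; rewrite hact_mul amul_swr.
    by apply: eq_sw => r s; rewrite !amulA.
  rewrite -sw_assoc; try by lin.
  by apply: eq_sw => w u; rewrite -amul_swl.
- rewrite /conv.
  transitivity (\sw_(p, u <- g) \sw_(q, r <- u) (a p · b q · (r ▷ x))); last first.
    by rewrite -sw_assoc; [apply: eq_sw => w u; rewrite -amul_swl | lin..].
  transitivity (\sw_(p, u <- g) \sw_(q, r <- u) (a p · (q ▷ x) · b r)); last first.
    by apply: eq_sw => p u; apply: U_comm2.
  rewrite -sw_assoc; try by lin.
  transitivity (\sw_(w, r <- g) \sw_(p, q <- w) ((p ▷ x) · a q · b r)).
    rewrite sw_assoc; try by lin.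
    by do 2![apply: eq_sw => ? ?; rewrite ?amul_swr ?amulA].
  by apply: eq_sw => w r; rewrite -!amul_swl (U_comm Ua).
- rewrite -[LHS]/(conv (conv a b) (conv_inv (conv a b)) g).
  have la' := conv_inv_lin la; have lb' := conv_inv_lin lb.
  rewrite conv_inv_conv // convA //; last exact: conv_lin.
  rewrite -(convA la lb lb') (inU_conv_inv Ub) conv1r //.
  by rewrite (inU_conv_inv Ua).
Qed.

Definition conv_linv b g : B := \sw_(g1, g2 <- g) (g1 ▷ b (antipode g2)).

Lemma conv_linvP b : inU b -> conv (conv_linv b) b = conv_one.
Proof.
move=> Ub; have lb : slin false b := U_lin Ub.
apply/funext => g; symmetry.
transitivity (\sw_(x, q <- g) \sw_(y, z <- q) (x ▷ b (antipode y · z))).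
  rewrite -[LHS](sw_counitr conv_one); last exact: conv_one_lin.
  apply: eq_sw => x q.
  rewrite (sw_antipodel (L := fun y => x ▷ b y)); last by lin.
  by rewrite (U_one Ub) hact1r /conv_one.
transitivity (\sw_(x, q <- g) \sw_(y, z <- q) \sw_(x1, x2 <- x) \sw_(y1, y2 <- y)
   ((x1 ▷ b (antipode y2)) · ((x2 · antipode y1) ▷ b z))).
  apply: eq_sw => x q; apply: eq_sw => y z.
  rewrite (U_mul Ub) hact_sw sw_antipode; last by lin.
  rewrite [RHS]sw_exch; apply: eq_sw => y1 y2.
  by rewrite hact_mul; apply: eq_sw => x1 x2; rewrite hactM.
rewrite -sw_assoc; try by lin.
apply: eq_sw => p z; rewrite /conv_linv amul_swl.
transitivity (\sw_(x1, t <- p) \sw_(x2, y <- t) \sw_(y1, y2 <- y)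
   ((x1 ▷ b (antipode y2)) · ((x2 · antipode y1) ▷ b z))).
  transitivity (\sw_(x, y <- p) \sw_(x1, x2 <- x) \sw_(y1, y2 <- y)
     ((x1 ▷ b (antipode y2)) · ((x2 · antipode y1) ▷ b z))) => //.
  by rewrite sw_assoc; lin.
apply: eq_sw => x1 t; rewrite -sw_assoc; try by lin.
rewrite -[RHS](sw_counitl (fun k => (x1 ▷ b (antipode k)) · b z)); last by lin.
apply: eq_sw => u y2.
rewrite (sw_antipoder (L := fun k => (x1 ▷ b (antipode y2)) · (k ▷ b z))).
  by rewrite hact1l.
by lin.
Qed.

Lemma conv_linv_lin b : slin false b -> slin false (conv_linv b).
Proof. by move=> lb; rewrite /conv_linv; lin. Qed.

Lemma conv_inv_convl b : inU b -> conv (conv_inv b) b = conv_one.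
Proof.
move=> Ub; have lb : slin false b := U_lin Ub.
have lb' := conv_inv_lin lb; have ll := conv_linv_lin lb.
suff -> : conv_inv b = conv_linv b by exact: conv_linvP.
by rewrite -[LHS](conv1l lb') -(conv_linvP Ub) -convA // inU_conv_inv // conv1r.
Qed.

Lemma inU_inv b : inU b -> inU (conv_inv b).
Proof.
move=> Ub; have lb : slin false b := U_lin Ub.
have lb' := conv_inv_lin lb.
have comm g x : \sw_(g1, g2 <- g) ((g1 ▷ x) · conv_inv b g2)
    = \sw_(g1, g2 <- g) (conv_inv b g1 · (g2 ▷ x)).
  pose al := fun k : H => k ▷ x.
  have lal : slin false al by rewrite /al; lin.
  have e : conv al b = conv b al by apply/funext => k; apply: U_comm Ub k x.
  rewrite -[LHS]/(conv al (conv_inv b) g) -[RHS]/(conv (conv_inv b) al g).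
  have lc := conv_lin lal lb'.
  rewrite -[in LHS](conv1l lc) -(conv_inv_convl Ub) -convA //.
  by rewrite (convA lb lal lb') -e -(convA lal lb lb') inU_conv_inv // conv1r.
split=> [||g h|//|g].
- exact: lb'.
- by rewrite /conv_inv antipode1 star1 (U_one Ub) star1.
- pose F g h := b (g · h); pose G g h := conv_inv b (g · h).
  pose K g h := \sw_(g1, g2 <- g) (conv_inv b g1 · (g2 ▷ conv_inv b h)).
  apply: (@conv2_uniq _ _ _ F G K); rewrite /F /G /K; try by lin.
  + move=> g' h'.
    rewrite -(sw_mul (F := fun k l => conv_inv b k · b l)); last by lin.
    rewrite -[LHS]/(conv (conv_inv b) b (g' · h')) conv_inv_convl //.
    by rewrite /conv_one counitM.
  + move=> g' h'.
    transitivity (\sw_(h1, h2 <- h') \sw_(g1, g2 <- g')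
        \sw_(p, q <- g1) \sw_(r, s <- g2)
        (b p · (q ▷ b h1) · (r ▷ conv_inv b h2) · conv_inv b s)).
      rewrite [RHS]sw_exch; apply: eq_sw => g1 g2; apply: eq_sw => h1 h2.
      rewrite (U_mul Ub) amul_swl; apply: eq_sw => p q.
      by rewrite -comm amul_swr; apply: eq_sw => r s; rewrite !amulA.
    transitivity (\sw_(p, t <- g') \sw_(w, s <- t)
      (b p · (w ▷ conv_one h') · conv_inv b s)).
      under eq_sw => h1 h2.
        rewrite sw_mid; try by lin.
      over.
      rewrite sw_exch; apply: eq_sw => p t; rewrite sw_exch; apply: eq_sw => w s.
      rewrite -(inU_conv_inv Ub) /conv hact_sw amul_swr amul_swl.
      apply: eq_sw => h1 h2; rewrite hact_mul amul_swr amul_swl.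
      by apply: eq_sw => q r; rewrite !amulA.
    transitivity (counit h' *: conv b (conv_inv b) g').
      rewrite /conv scale_sw; apply: eq_sw => p t.
      rewrite -(sw_counitl (fun s => counit h' *: (b p · conv_inv b s))); last by lin.
      apply: eq_sw => w s.
      by rewrite hact_aoneZ amulZr amulZl amul1r scalerA mulrC.
    by rewrite inU_conv_inv // /conv_one scalerA mulrC.
- rewrite -[LHS]/(conv (conv_inv b) (conv_inv (conv_inv b)) g) conv_invK.
  by rewrite conv_inv_convl.
Qed.

End Convolution.

Section GroupU.
Variables (R : realDomainType) (H : hopfStarType R) (B : hStarAlgType H).
Implicit Types (g h : H) (c d x : B).

Record Ugroup : Type := MkU { Uval :> H -> B; UvalP : inU Uval }.

HB.instance Definition _ := gen_eqMixin Ugroup.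
HB.instance Definition _ := gen_choiceMixin Ugroup.

Implicit Types a b : Ugroup.

Lemma Uval_inj : injective Uval.
Proof.
by case=> f Uf [f' Uf'] /= e; subst f'; congr MkU; apply: Prop_irrelevance.
Qed.

Definition Umul a b := MkU (inU_conv (UvalP a) (UvalP b)).
Definition Uone := MkU (inU_one B).
Definition Uinv a := MkU (inU_inv (UvalP a)).

Lemma Uval_lin a : slin false a.
Proof. exact: U_lin (UvalP a). Qed.

Fact UmulA : associative Umul.
Proof. by move=> a b c; apply: Uval_inj; apply: convA; apply: Uval_lin. Qed.

Fact Umul1l : left_id Uone Umul.
Proof. by move=> a; apply: Uval_inj; apply/conv1l/Uval_lin. Qed.

Fact Umul1r : right_id Uone Umul.
Proof. by move=> a; apply: Uval_inj; apply/conv1r/Uval_lin. Qed.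

Fact UmulVl : left_inverse Uone Uinv Umul.
Proof. by move=> a; apply: Uval_inj; apply/conv_inv_convl/UvalP. Qed.

Fact UmulVr : right_inverse Uone Uinv Umul.
Proof. by move=> a; apply: Uval_inj; apply/inU_conv_inv/UvalP. Qed.

HB.instance Definition _ := isGroup.Build Ugroup
  UmulA Umul1l Umul1r UmulVl UmulVr.

Record inUZ c : Prop := {
  UZ_central : forall x, c · x = x · c;
  UZ_mulVl : c^⋆ · c = aone;
  UZ_mulVr : c · c^⋆ = aone }.

(* c^-1 = c^⋆ since c is unitary *)
Definition hat c g : B := c · (g ▷ c^⋆).

Lemma inUZ_star c : inUZ c -> inUZ c^⋆.
Proof.
case=> cC cl cr; split=> [x||]; rewrite ?starK //.
by rewrite -[x]starK -!starM cC.
Qed.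

Lemma inUZ_mul c d : inUZ c -> inUZ d -> inUZ (c · d).
Proof.
case=> cC cl cr [dC dl dr]; split=> [x||].
- by rewrite -amulA dC !amulA cC.
- by rewrite starM -amulA (amulA c^⋆) cl amul1l.
- by rewrite starM amulA -(amulA c) dr amul1r.
Qed.

Lemma inUZ_one : inUZ aone.
Proof. by split=> *; rewrite ?star1 ?amul1l ?amul1r. Qed.

Lemma hat_conv c d : inUZ c -> inUZ d -> conv (hat c) (hat d) = hat (c · d).
Proof.
move=> Uc Ud; apply/funext => g; rewrite /conv /hat starM.
rewrite (UZ_central (inUZ_star Ud)) hact_mul amul_swr; apply: eq_sw => g1 g2.
by rewrite -!amulA (amulA _ d) -(UZ_central Ud) !amulA.
Qed.

Lemma hat1 : hat aone = conv_one B.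
Proof. by apply/funext => g; rewrite /hat star1 amul1l hact1r. Qed.

Lemma hat_lin c : slin false (hat c).
Proof. by rewrite /hat; lin. Qed.

Lemma inU_hat c : inUZ c -> inU (hat c).
Proof.
move=> Uc; have Uc' := inUZ_star Uc; split=> [||g h|g x|g].
- exact: hat_lin.
- by rewrite /hat hact1l (UZ_mulVr Uc).
- transitivity (c · (g ▷ (c^⋆ · (c · (h ▷ c^⋆))))).
    by rewrite amulA (UZ_mulVl Uc) amul1l -hactM.
  by rewrite hact_mul amul_swr; apply: eq_sw => g1 g2; rewrite amulA.
- transitivity (c · (g ▷ (x · c^⋆))).
    rewrite hact_mul amul_swr; apply: eq_sw => g1 g2.
    by rewrite !amulA (UZ_central Uc).
  rewrite -(UZ_central Uc') hact_mul amul_swr.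
  by apply: eq_sw => g1 g2; rewrite amulA.
- transitivity (c · (g ▷ (c^⋆ · c)) · c^⋆).
    rewrite hact_mul amul_swr amul_swl; apply: eq_sw => g1 g2.
    by rewrite starM hact_star starK antipode_star !amulA.
  by rewrite (UZ_mulVl Uc) hact1r amulZr amulZl amul1r (UZ_mulVr Uc).
Qed.

Lemma hat_comm c a : inUZ c -> conv (hat c) a = conv a (hat c).
Proof.
move=> Uc; have Uc' := inUZ_star Uc; apply/funext => g.
transitivity (c · \sw_(g1, g2 <- g) ((g1 ▷ c^⋆) · a g2)).
  by rewrite amul_swr; apply: eq_sw => g1 g2; rewrite amulA.
rewrite (U_comm (UvalP a)) amul_swr; apply: eq_sw => g1 g2.
by rewrite /hat !amulA (UZ_central Uc).
Qed.

Definition Uhat c (Uc : inUZ c) : Ugroup := MkU (inU_hat Uc).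

(* a and b lie in the same coset of the image of c |-> hat c *)
Definition U0_eq a b : Prop :=
  exists c (Uc : inUZ c), a = (Uhat Uc * b)%g.

Definition U0_eqb a b : bool := `[< U0_eq a b >].

Lemma U0_eq_refl a : U0_eq a a.
Proof.
exists aone, inUZ_one; apply: Uval_inj.
by rewrite /= hat1 conv1l //; apply: Uval_lin.
Qed.

Lemma U0_eq_sym a b : U0_eq a b -> U0_eq b a.
Proof.
case=> c [Uc ->]; exists c^⋆, (inUZ_star Uc); apply: Uval_inj => /=.
have lb := @Uval_lin b; have lc := @hat_lin c; have lc' := @hat_lin c^⋆.
by rewrite (convA lc' lc lb) (hat_conv (inUZ_star Uc) Uc) (UZ_mulVl Uc) hat1 conv1l.
Qed.

Lemma U0_eq_trans a b f : U0_eq a b -> U0_eq b f -> U0_eq a f.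
Proof.
case=> c [Uc ->] [c' [Uc' ->]]; exists (c · c'), (inUZ_mul Uc Uc').
apply: Uval_inj; rewrite /= -(hat_conv Uc Uc') convA //; [exact: hat_lin..|].
exact: Uval_lin.
Qed.

Lemma U0_eqb_refl : reflexive U0_eqb.
Proof. by move=> a; apply/asboolP/U0_eq_refl. Qed.

Lemma U0_eqb_sym : symmetric U0_eqb.
Proof. by move=> a b; apply: asbool_equiv_eq; split; apply: U0_eq_sym. Qed.

Lemma U0_eqb_trans : transitive U0_eqb.
Proof.
by move=> b a f /asboolP ab /asboolP bd; apply/asboolP/(U0_eq_trans ab bd).
Qed.

Canonical U0_equiv := EquivRel U0_eqb U0_eqb_refl U0_eqb_sym U0_eqb_trans.

Definition U0 := {eq_quot U0_equiv}.
HB.instance Definition _ := Choice.on U0.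

Definition U0class a : U0 := \pi_({eq_quot U0_equiv}) a.

Lemma U0classP a b : U0class a = U0class b <-> U0_eq a b.
Proof.
by split=> [/eqmodP/asboolP|e]; last apply/eqmodP/asboolP.
Qed.

Lemma U0reprK (x : U0) : U0class (repr x) = x.
Proof. exact: reprK. Qed.

Definition U0mul (x y : U0) : U0 := U0class (repr x * repr y)%g.
Definition U0one : U0 := U0class 1%g.
Definition U0inv (x : U0) : U0 := U0class (repr x)^-1%g.

Lemma Uhat_comm c (Uc : inUZ c) a : (Uhat Uc * a = a * Uhat Uc)%g.
Proof. by apply: Uval_inj; apply: hat_comm. Qed.

Lemma U0mulE a b : U0mul (U0class a) (U0class b) = U0class (a * b)%g.
Proof.
apply/U0classP; rewrite /U0mul.
have /U0classP [c [Uc ->]] := U0reprK (U0class a).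
have /U0classP [d [Ud ->]] := U0reprK (U0class b).
exists (c · d), (inUZ_mul Uc Ud).
have -> : Uhat (inUZ_mul Uc Ud) = (Uhat Uc * Uhat Ud)%g.
  by apply: Uval_inj; rewrite /= hat_conv.
by rewrite -!mulgA; congr (_ * _)%g; rewrite !mulgA -Uhat_comm.
Qed.

Fact U0mulA : associative U0mul.
Proof.
move=> x y z; rewrite -(U0reprK x) -(U0reprK y) -(U0reprK z).
by rewrite !U0mulE mulgA.
Qed.

Fact U0mul1l : left_id U0one U0mul.
Proof. by move=> x; rewrite -(U0reprK x) U0mulE mul1g. Qed.

Fact U0mul1r : right_id U0one U0mul.
Proof. by move=> x; rewrite -(U0reprK x) U0mulE mulg1. Qed.

Fact U0mulVl : left_inverse U0one U0inv U0mul.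
Proof. by move=> x; rewrite -[in X in U0mul _ X](U0reprK x) U0mulE mulVg. Qed.

Fact U0mulVr : right_inverse U0one U0inv U0mul.
Proof. by move=> x; rewrite -[in X in U0mul X _](U0reprK x) U0mulE mulgV. Qed.

HB.instance Definition _ := isGroup.Build U0
  U0mulA U0mul1l U0mul1r U0mulVl U0mulVr.

End GroupU.

Section Positivity.
Variables (R : realDomainType) (A : starAlgType R) (n : nat).
Local Notation C := (cplx R).
Implicit Types (a b : 'M[A]_n) (w : 'M[A]_n -> C).

(* mulmx and the library scaling of 'M[A]_n need a library ring structure on
   the entries, which a starAlgType does not carry. *)
Definition mxs_mul a b : 'M[A]_n := \matrix_(i, j) \sum_k (a i k · b k j).
Definition mxs_scale (c : C) a : 'M[A]_n := \matrix_(i, j) (c *: a i j).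
Definition mxs_star a : 'M[A]_n := \matrix_(i, j) (a j i)^⋆.

Definition positive_functional w : Prop :=
  (forall c a b, w (mxs_scale c a + b) = c * w a + w b) /\
  (forall a, cnonneg (w (mxs_mul (mxs_star a) a))).

Definition mx_positive a : Prop :=
  forall w, positive_functional w -> cnonneg (w a).

End Positivity.

Section EquivalenceBimodules.
Variables (R : realDomainType) (B A : starAlgType R).
Local Notation C := (cplx R).

Record is_bimodule (E : lmodType C) (l : B -> E -> E) (r : E -> A -> E) :
    Prop := {
  lact_linl : forall x, linear (l^~ x);
  lact_linr : forall b, linear (l b);
  lactM : forall b b' x, l (b · b') x = l b (l b' x);
  lact1 : forall x, l aone x = x;
  ract_linl : forall a, linear (r^~ a);
  ract_linr : forall x, linear (r x);
  ractM : forall x a a', r x (a · a') = r (r x a) a';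
  ract1 : forall x, r x aone = x;
  lract : forall b x a, r (l b x) a = l b (r x a) }.

Section InnerProduct.
Variables (D : starAlgType R) (E : lmodType C) (ip : E -> E -> D).

Definition nondegenerate : Prop := forall x, (forall y, ip x y = 0) -> x = 0.

Definition full : Prop := forall d, exists s : seq (C * E * E),
  d = \sum_(p <- s) p.1.1 *: ip p.1.2 p.2.

Definition completely_positive : Prop := forall n (x : 'I_n -> E),
  mx_positive (\matrix_(i, j) ip (x i) (x j)).

End InnerProduct.

Record is_right_inner (E : lmodType C) (r : E -> A -> E) (ip : E -> E -> A) :
    Prop := {
  ripl : forall c x x' y, ip (c *: x + x') y = cconj c *: ip x y + ip x' y;
  ripr : forall x, linear (ip x);
  rip_sym : forall x y, ip x y = (ip y x)^⋆;
  rip_act : forall x y a, ip x (r y a) = ip x y · a }.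

Record is_left_inner (E : lmodType C) (l : B -> E -> E) (ip : E -> E -> B) :
    Prop := {
  lipl : forall y, linear (ip^~ y);
  lipr : forall c x y y', ip x (c *: y + y') = cconj c *: ip x y + ip x y';
  lip_sym : forall x y, ip x y = (ip y x)^⋆;
  lip_act : forall b x y, ip (l b x) y = b · ip x y }.

Record equivBimod : Type := EquivBimod {
  carrier :> lmodType C;
  lact : B -> carrier -> carrier;
  ract : carrier -> A -> carrier;
  ipB : carrier -> carrier -> B;
  ipA : carrier -> carrier -> A;
  bimoduleP : is_bimodule lact ract;
  ipB_inner : is_left_inner lact ipB;
  ipB_full : full ipB;
  ipB_nondeg : nondegenerate ipB;
  ipB_cpos : completely_positive ipB;
  ipA_inner : is_right_inner ract ipA;
  ipA_full : full ipA;
  ipA_nondeg : nondegenerate ipA;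
  ipA_cpos : completely_positive ipA;
  ipA_lact : forall b x y, ipA (lact b x) y = ipA x (lact b^⋆ y);
  ipB_ract : forall x a y, ipB (ract x a) y = ipB x (ract y a^⋆);
  ip_compat : forall x y z, lact (ipB x y) z = ract x (ipA y z) }.

Record bimod_iso (E E' : equivBimod) (f : E -> E') : Prop := {
  iso_lin : linear f;
  iso_bij : bijective f;
  iso_lact : forall b x, f (lact b x) = lact b (f x);
  iso_ract : forall x a, f (ract x a) = ract (f x) a;
  iso_ipB : forall x y, ipB (f x) (f y) = ipB x y;
  iso_ipA : forall x y, ipA (f x) (f y) = ipA x y }.

Definition isomorphic (E E' : equivBimod) : Prop :=
  exists f : E -> E', bimod_iso f.

(* An isomorphism class is represented by the predicate of its members. *)
Definition Pic : Type :=
  { X : equivBimod -> Prop | exists E, X = isomorphic E }.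

Definition Pic_class (E : equivBimod) : Pic :=
  exist _ (isomorphic E) (ex_intro _ E erefl).

Lemma isomorphic_refl E : isomorphic E E.
Proof. by exists id; split=> //; exists id. Qed.

Lemma bimod_iso_comp (E1 E2 E3 : equivBimod) (f : E1 -> E2) (f' : E2 -> E3) :
  bimod_iso f -> bimod_iso f' -> bimod_iso (f' \o f).
Proof.
case=> fl fb fL fR fB fA [fl' fb' fL' fR' fB' fA']; split=> /=.
- by move=> c x y /=; rewrite fl fl'.
- exact: bij_comp.
- by move=> b x; rewrite fL fL'.
- by move=> x a; rewrite fR fR'.
- by move=> x y; rewrite fB' fB.
- by move=> x y; rewrite fA' fA.
Qed.

Lemma isomorphic_trans E1 E2 E3 :
  isomorphic E1 E2 -> isomorphic E2 E3 -> isomorphic E1 E3.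
Proof. by case=> f ff [f' ff']; exists (f' \o f); apply: bimod_iso_comp. Qed.

End EquivalenceBimodules.

Section Covariant.
Variables (R : realDomainType) (H : hopfStarType R) (B A : hStarAlgType H).
Local Notation C := (cplx R).

Record covariant (E : equivBimod B A) (t : H -> E -> E) : Prop := {
  cov_linl : forall x, linear (t^~ x);
  cov_linr : forall g, linear (t g);
  covM : forall g h x, t (g · h) x = t g (t h x);
  cov1 : forall x, t aone x = x;
  cov_ipA : forall g x y,
    g ▷ ipA x y = \sw_(g1, g2 <- g) ipA (t (antipode g1)^⋆ x) (t g2 y);
  cov_ipB : forall g x y,
    g ▷ ipB x y = \sw_(g1, g2 <- g) ipB (t g1 x) (t (antipode g2)^⋆ y) }.

Record covBimod : Type := CovBimod {
  cov_bimod :> equivBimod B A;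
  cov_act : H -> cov_bimod -> cov_bimod;
  cov_actP : covariant cov_act }.

Definition cov_isomorphic (E E' : covBimod) : Prop :=
  exists f : E -> E',
    bimod_iso f /\ forall g x, f (cov_act g x) = cov_act g (f x).

Definition PicH : Type :=
  { X : covBimod -> Prop | exists E, X = cov_isomorphic E }.

Definition PicH_class (E : covBimod) : PicH :=
  exist _ (cov_isomorphic E) (ex_intro _ E erefl).

Lemma cov_isomorphic_refl E : cov_isomorphic E E.
Proof. by exists id; split=> //; split=> //; exists id. Qed.

Definition forget_pred (X : covBimod -> Prop) (E : equivBimod B A) : Prop :=
  exists2 F : covBimod, X F & isomorphic F E.

Lemma forget_predE (F : covBimod) :
  forget_pred (cov_isomorphic F) = isomorphic (F : equivBimod B A).
Proof.
apply/funext => E; apply/propext; split.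
  by case=> F' [f [ff _]]; apply: isomorphic_trans; exists f.
by exists F => //; apply: cov_isomorphic_refl.
Qed.

Lemma forget_subproof (X : PicH) :
  exists E, forget_pred (sval X) = isomorphic E.
Proof. by have [F ->] := svalP X; exists F; apply: forget_predE. Qed.

Definition forget (X : PicH) : Pic B A :=
  exist _ (forget_pred (sval X)) (forget_subproof X).

Lemma forgetE (F : covBimod) : forget (PicH_class F) = Pic_class F.
Proof. by apply: eq_exist; apply: forget_predE. Qed.

Definition twist (E : equivBimod B A) (t : H -> E -> E) (b : H -> B)
    (g : H) (x : E) : E :=
  \sw_(g1, g2 <- g) lact (b g1) (t g2 x).

End Covariant.

(* G acts on X from the left, preserving the fibres of p : X -> Y, and acts
   freely and transitively on each of them. *)
Record principal_bundle (G : groupType) (X Y : Type) (p : X -> Y)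
    (act : G -> X -> X) : Prop := {
  pb_act1 : forall x, act 1%g x = x;
  pb_actM : forall u v x, act (u * v)%g x = act u (act v x);
  pb_fibre : forall u x, p (act u x) = p x;
  pb_free : forall u x, act u x = x -> u = 1%g;
  pb_trans : forall x x', p x = p x' -> exists u, act u x = x' }.

(* Main.v *)
(* Covariance of the two inner products, with their fullness and
   non-degeneracy, makes H act compatibly with both module structures, and
   any two H-actions on the same bimodule differ by a cocycle: with
   1 = sum of k <x, y>, the sums of k <g1 .' x, S(g2)^⋆ . y> define b in
   U(H, B) with .' = .^b.  The stabiliser is found from the fact that an
   automorphism of the bimodule is the action of a unitary central c; if it
   intertwines .^b and ., then c b(g) = g ▷ c, so that b is the hat of c^⋆.
   Conversely c intertwines . and .^(hat c), whence the action of U0. *)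

Require Import Defs.
From mathcomp Require Import all_boot all_order all_algebra.
From mathcomp Require Import boolp.

Set Implicit Arguments.
Unset Strict Implicit.
Unset Printing Implicit Defensive.

Import GRing.Theory.
Local Open Scope ring_scope.
Local Open Scope star_scope.
Local Notation S := antipode.

(** * The antipode on products, and sums under the Sweedler notation *)

Section Generalities.
Variables (R : realDomainType) (H : hopfStarType R).
Local Notation C := (cplx R).

(** Both sides are convolution inverses of the multiplication map in Hom (H ⊗ H, H), the left side
    on the left and the right side on the right, so [conv2_uniq] identifies them. *)
Lemma antipodeM (g h : H) : S (g · h) = S h · S g.
Proof.
apply: (conv2_uniq (F := fun g h : H => g · h) (G := fun g h => S (g · h))
  (K := fun g h => S h · S g)); try by lin.
  move=> g' h'; rewrite -(sw_mul (F := fun a b => S a · b)); last by lin.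
  by rewrite antipodel counitM.
move=> g' h'.
transitivity (\sw_(a, b <- g') (a · (\sw_(c, d <- h') (c · S d)) · S b)).
  apply: eq_sw => a b; rewrite amul_swr amul_swl.
  by apply: eq_sw => c d; rewrite !amulA.
rewrite antipoder.
transitivity (\sw_(a, b <- g') (counit h' *: (a · S b))).
  by apply: eq_sw => a b; rewrite amulZr amul1r amulZl.
by rewrite -scale_sw antipoder scalerA mulrC.
Qed.

Lemma sw_sum (W : zmodType) I (r : seq I) (F : I -> H -> H -> W) (g : H) :
  sweedler g (fun a b => \sum_(i <- r) F i a b)
  = \sum_(i <- r) sweedler g (F i).
Proof. exact: exchange_big. Qed.

Lemma slin_bigsum (U V : lmodType C) s I (r : seq I) (F : I -> U -> V) :
  (forall i, slin s (F i)) -> slin s (fun x => \sum_(i <- r) F i x).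
Proof.
move=> lF c x y; rewrite scaler_sumr -big_split /=.
by apply: eq_bigr => i _; rewrite lF.
Qed.

End Generalities.

(** * Linearity and conjugate-linearity of the bimodule operations *)

Section Bimodule.
Variables (R : realDomainType) (B A : starAlgType R) (E : equivBimod B A).
Local Notation C := (cplx R).

Lemma slin_lactl (U : lmodType C) s (f : U -> B) (x : E) :
  slin s f -> slin s (fun u => lact (f u) x).
Proof. by move=> lf c u v; rewrite lf (lact_linl (bimoduleP E)). Qed.

Lemma slin_lactr (U : lmodType C) s (f : U -> E) (b : B) :
  slin s f -> slin s (fun u => lact b (f u)).
Proof. by move=> lf c u v; rewrite lf (lact_linr (bimoduleP E)). Qed.

Lemma slin_ractl (U : lmodType C) s (f : U -> E) (a : A) :
  slin s f -> slin s (fun u => ract (f u) a).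
Proof. by move=> lf c u v; rewrite lf (ract_linl (bimoduleP E)). Qed.

Lemma slin_ractr (U : lmodType C) s (f : U -> A) (x : E) :
  slin s f -> slin s (fun u => ract x (f u)).
Proof. by move=> lf c u v; rewrite lf (ract_linr (bimoduleP E)). Qed.

Lemma slin_ipBl (U : lmodType C) s (f : U -> E) (y : E) :
  slin s f -> slin s (fun u => ipB (f u) y).
Proof. by move=> lf c u v; rewrite lf (lipl (ipB_inner E)). Qed.

Lemma slin_ipBr (U : lmodType C) s (f : U -> E) (x : E) :
  slin (~~ s) f -> slin s (fun u => ipB x (f u)).
Proof.
by move=> lf c u v; rewrite lf (lipr (ipB_inner E)); case: s {lf}; rewrite ?cconjK.
Qed.

Lemma slin_ipAl (U : lmodType C) s (f : U -> E) (y : E) :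
  slin (~~ s) f -> slin s (fun u => ipA (f u) y).
Proof.
by move=> lf c u v; rewrite lf (ripl (ipA_inner E)); case: s {lf}; rewrite ?cconjK.
Qed.

Lemma slin_ipAr (U : lmodType C) s (f : U -> E) (x : E) :
  slin s f -> slin s (fun u => ipA x (f u)).
Proof. by move=> lf c u v; rewrite lf (ripr (ipA_inner E)). Qed.

End Bimodule.

(** Extends [lin] to the bimodule operations. In the conjugate-linear slots, the second of [ipB] and
    the first of [ipA], the search continues with the opposite flag. *)
Ltac blin :=
  repeat (lin; cbv beta; match goal with
  | |- slin ?s (fun x => lact (@?f x) ?v) => refine (@slin_lactl _ _ _ _ _ s f v _)
  | |- slin ?s (fun x => lact ?b (@?f x)) => refine (@slin_lactr _ _ _ _ _ s f b _)
  | |- slin ?s (fun x => ract (@?f x) ?a) => refine (@slin_ractl _ _ _ _ _ s f a _)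
  | |- slin ?s (fun x => ract ?v (@?f x)) => refine (@slin_ractr _ _ _ _ _ s f v _)
  | |- slin ?s (fun x => ipB (@?f x) ?y) => refine (@slin_ipBl _ _ _ _ _ s f y _)
  | |- slin ?s (fun x => ipB ?y (@?f x)) =>
      refine (@slin_ipBr _ _ _ _ _ s f y _); unfold negb
  | |- slin ?s (fun x => ipA (@?f x) ?y) =>
      refine (@slin_ipAl _ _ _ _ _ s f y _); unfold negb
  | |- slin ?s (fun x => ipA ?y (@?f x)) => refine (@slin_ipAr _ _ _ _ _ s f y _)
  | |- slin ?s (fun x => \sum_(i <- ?r) @?F x i) =>
      refine (@slin_bigsum _ _ _ s _ r (fun i x => F x i) _)
  end); lin.

(** * Consequences of non-degeneracy and fullness *)

Section BimoduleTheory.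
Variables (R : realDomainType) (B A : starAlgType R) (E : equivBimod B A).
Local Notation C := (cplx R).
Implicit Types (x y z : E) (b c : B).

Lemma lactA b c x : lact (b · c) x = lact b (lact c x).
Proof. exact: lactM (bimoduleP E) b c x. Qed.

Lemma lact1E x : lact aone x = x.
Proof. exact: lact1 (bimoduleP E) x. Qed.

Lemma lactZl (k : C) b x : lact (k *: b) x = k *: lact b x.
Proof. by rewrite (slin_Z (f := fun b => lact b x) (s := false)) //; blin. Qed.

Lemma ipA_Zr (k : C) x y : ipA x (k *: y) = k *: ipA x y.
Proof. by rewrite (slin_Z (f := fun y => ipA x y) (s := false)) //; blin. Qed.

Lemma ipB_lactl b x y : ipB (lact b x) y = b · ipB x y.
Proof. exact: lip_act (ipB_inner E) b x y. Qed.

Lemma ipB_lactr b x y : ipB x (lact b y) = ipB x y · b^⋆.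
Proof.
by rewrite (lip_sym (ipB_inner E)) ipB_lactl starM -(lip_sym (ipB_inner E)).
Qed.

Lemma ipA_ractr x y a : ipA x (ract y a) = ipA x y · a.
Proof. exact: rip_act (ipA_inner E) x y a. Qed.

Lemma ipB_ext x x' : (forall y, ipB x y = ipB x' y) -> x = x'.
Proof.
move=> e; apply/eqP; rewrite -subr_eq0; apply/eqP/(@ipB_nondeg _ _ _ E) => y.
have l : slin false (fun x => ipB x y) by blin.
by rewrite -scaleN1r addrC l e scaleN1r addNr.
Qed.

Lemma ipA_ext x x' : (forall z, ipA z x = ipA z x') -> x = x'.
Proof.
move=> e; apply/eqP; rewrite -subr_eq0; apply/eqP/(@ipA_nondeg _ _ _ E) => z.
have l : slin false (fun x => ipA z x) by blin.
rewrite (rip_sym (ipA_inner E)) -scaleN1r addrC l e scaleN1r addNr.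
by apply: (slin_0 (s := true) (f := @star _ A)) => c u v; rewrite starD starZ.
Qed.

Lemma lact_sum I (r : seq I) F x :
  lact (\sum_(i <- r) F i) x = \sum_(i <- r) lact (F i) x.
Proof. by rewrite (slin_sum (f := fun b => lact b x) (s := false)); last by blin. Qed.

(** By fullness 1 is a sum of k <x, y>, and b · <x, y> = <b x, y> depends only on the action of
    b. *)
Lemma lact_faithful b c : (forall x, lact b x = lact c x) -> b = c.
Proof.
move=> e; have [s s1] := @ipB_full _ _ _ E aone.
have l d : slin false (amul d : B -> B) by exact: amul_linr.
rewrite -[b]amul1r -[c]amul1r s1 (slin_sum _ _ (l b)) (slin_sum _ _ (l c)).
by apply: eq_bigr => p _; rewrite !amulZr -!ipB_lactl e.
Qed.

End BimoduleTheory.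

(** * Cancellation for covariant actions, and compatibility with the module structures *)

Section Covariance.
Variables (R : realDomainType) (H : hopfStarType R) (B A : hStarAlgType H).
Local Notation C := (cplx R).
Variables (E : equivBimod B A) (t : H -> E -> E) (Et : covariant t).
Implicit Types (x y z : E) (g h : H) (b : B) (a : A).

Lemma cov_bilin : bilin t.
Proof. by split=> [x|g]; [apply: cov_linl Et x | apply: cov_linr Et g]. Qed.

(* F g x is recovered as F g1 (g2 . (S g3 . x)). *)
Lemma cov_cancel (W : lmodType C) (F G : H -> E -> W) :
  bilin F -> bilin G ->
  (forall g x,
    \sw_(g1, g2 <- g) F g1 (t g2 x) = \sw_(g1, g2 <- g) G g1 (t g2 x)) ->
  forall g x, F g x = G g x.
Proof.
have key (K : H -> E -> W) g x : bilin K ->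
    K g x = \sw_(p, q <- g) \sw_(g1, g2 <- p) K g1 (t g2 (t (S q) x)).
  move=> bK; have bt := cov_bilin; rewrite sw_assoc; try by blin.
  rewrite -[LHS](sw_counitr (fun k => K k x)); last by blin.
  apply: eq_sw => g1 r.
  rewrite -[in LHS](cov1 Et x) -(sw_antipoder (L := fun h => K g1 (t h x))).
    by apply: eq_sw => g2 q; rewrite (covM Et).
  by blin.
move=> bF bG e g x; rewrite (key F) // (key G) //.
by apply: eq_sw => p q; apply: e.
Qed.

(** Using g1^⋆ . z in place of z in the given sums recovers <z, F g>: the product S(g2)^⋆ · g1^⋆ =
    (g1 · S(g2))^⋆ collapses to the counit. *)
Lemma ipA_cancel (F G : H -> E) :
  slin false F -> slin false G ->
  (forall g z, \sw_(g1, g2 <- g) ipA (t (S g1)^⋆ z) (F g2)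
     = \sw_(g1, g2 <- g) ipA (t (S g1)^⋆ z) (G g2)) ->
  forall g, F g = G g.
Proof.
have key (K : H -> E) g z : slin false K ->
    ipA z (K g) = \sw_(g1, r <- g) \sw_(g2, g3 <- r)
      ipA (t (S g2)^⋆ (t g1^⋆ z)) (K g3).
  move=> lK; have bt := cov_bilin; rewrite -sw_assoc; try by blin.
  rewrite -[LHS](sw_counitl (fun k => ipA z (K k))); last by blin.
  apply: eq_sw => p g3.
  rewrite -[in LHS](cov1 Et z) -[in LHS](star1 H).
  rewrite -(sw_antipoder (L := fun h => ipA (t h^⋆ z) (K g3))).
    by apply: eq_sw => g1 g2; rewrite starM (covM Et).
  by blin.
move=> lF lG e g; apply: ipA_ext => z; rewrite (key F) // (key G) //.
by apply: eq_sw => p q; apply: e.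
Qed.

(** Here y is replaced by S(S(g3))^⋆ . y, and S(g2)^⋆ · S(S(g3))^⋆ = S(g2 · S(g3))^⋆ by [antipodeM],
    which again collapses to the counit. *)
Lemma ipB_cancel (F G : H -> E) :
  slin false F -> slin false G ->
  (forall g y, \sw_(g1, g2 <- g) ipB (F g1) (t (S g2)^⋆ y)
     = \sw_(g1, g2 <- g) ipB (G g1) (t (S g2)^⋆ y)) ->
  forall g, F g = G g.
Proof.
have key (K : H -> E) g y : slin false K ->
    ipB (K g) y = \sw_(p, g3 <- g) \sw_(g1, g2 <- p)
      ipB (K g1) (t (S g2)^⋆ (t (S (S g3))^⋆ y)).
  move=> lK; have bt := cov_bilin; rewrite sw_assoc; try by blin.
  rewrite -[LHS](sw_counitr (fun k => ipB (K k) y)); last by blin.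
  apply: eq_sw => g1 r.
  rewrite -[in LHS](cov1 Et y) -[in LHS](star1 H) -[in LHS](antipode1 H).
  rewrite -(sw_antipoder (L := fun h => ipB (K g1) (t (S h)^⋆ y))).
    by apply: eq_sw => g2 g3; rewrite antipodeM starM (covM Et).
  by blin.
move=> lF lG e g; apply: ipB_ext => y; rewrite (key F) // (key G) //.
by apply: eq_sw => p q; apply: e.
Qed.

Lemma ipA_sw g (F : H -> H -> E) x :
  ipA x (sweedler g F) = \sw_(g1, g2 <- g) ipA x (F g1 g2).
Proof. by rewrite (sw_app (L := fun y => ipA x y) _ _ (s := false)); last by blin. Qed.

Lemma ipA_swl g (F : H -> H -> E) y :
  ipA (sweedler g F) y = \sw_(g1, g2 <- g) ipA (F g1 g2) y.
Proof.
by rewrite (sw_app (L := fun x => ipA x y) _ _ (s := true)); last by blin.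
Qed.

Lemma ipB_swl g (F : H -> H -> E) y :
  ipB (sweedler g F) y = \sw_(g1, g2 <- g) ipB (F g1 g2) y.
Proof. by rewrite (sw_app (L := fun x => ipB x y) _ _ (s := false)); last by blin. Qed.

Lemma ipB_swr g (F : H -> H -> E) x :
  ipB x (sweedler g F) = \sw_(g1, g2 <- g) ipB x (F g1 g2).
Proof. by rewrite (sw_app (L := fun y => ipB x y) _ _ (s := true)); last by blin. Qed.

Lemma lact_sw g (F : H -> H -> E) b :
  lact b (sweedler g F) = \sw_(g1, g2 <- g) lact b (F g1 g2).
Proof. by rewrite (sw_app (L := fun y => lact b y) _ _ (s := false)); last by blin. Qed.

Lemma lact_swl g (F : H -> H -> B) x :
  lact (sweedler g F) x = \sw_(g1, g2 <- g) lact (F g1 g2) x.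
Proof. by rewrite (sw_app (L := fun b => lact b x) _ _ (s := false)); last by blin. Qed.

Lemma cov_sw g h (F : H -> H -> E) :
  t g (sweedler h F) = \sw_(h1, h2 <- h) t g (F h1 h2).
Proof.
have bt := cov_bilin.
by rewrite (sw_app (L := fun x => t g x) _ _ (s := false)); last by blin.
Qed.

(** Paired with S(g1)^⋆ . z under [ipA], both sides give g ▷ (<z, x> · a), so [ipA_cancel]
    applies. *)
Lemma cov_ract g x a :
  t g (ract x a) = \sw_(g1, g2 <- g) ract (t g1 x) (g2 ▷ a).
Proof.
have bt := cov_bilin; move: g; apply: ipA_cancel; try by blin.
move=> g z; rewrite -(cov_ipA Et) ipA_ractr hact_mul.
under eq_sw do rewrite (cov_ipA Et) amul_swl.
rewrite sw_assoc; try by blin.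
apply: eq_sw => g1 r; rewrite ipA_sw.
by apply: eq_sw => g2 g3; rewrite ipA_ractr.
Qed.

(** The mirror argument: paired with S(g2)^⋆ . y under [ipB], both sides give g ▷ (b · <x, y>). *)
Lemma cov_lact g b x :
  t g (lact b x) = \sw_(g1, g2 <- g) lact (g1 ▷ b) (t g2 x).
Proof.
have bt := cov_bilin; move: g; apply: ipB_cancel; try by blin.
move=> g y; rewrite -(cov_ipB Et) ipB_lactl hact_mul.
under eq_sw do rewrite (cov_ipB Et) amul_swr.
rewrite -sw_assoc; try by blin.
apply: eq_sw => r g3; rewrite ipB_swl.
by apply: eq_sw => g1 g2; rewrite ipB_lactl.
Qed.

(** * Twisting a covariant action by an element of U(H, B) *)

Lemma twist_bilin (b : H -> B) : slin false b -> bilin (twist t b).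
Proof. by move=> lb; have bt := cov_bilin; rewrite /twist; blin. Qed.

Lemma twist_conv (b c : H -> B) : slin false b -> slin false c ->
  twist t (conv b c) = twist (twist t c) b.
Proof.
move=> lb lc; have bt := cov_bilin; apply/funext => g; apply/funext => x.
rewrite /twist /conv.
under eq_sw do rewrite lact_swl.
under [RHS]eq_sw do rewrite lact_sw.
rewrite sw_assoc; try by blin.
by do 2![apply: eq_sw => ? ?]; rewrite lactA.
Qed.

Lemma twist_one : twist t (conv_one B) = t.
Proof.
have bt := cov_bilin; apply/funext => g; apply/funext => x.
rewrite /twist /conv_one -[RHS](sw_counitl (fun k => t k x)); last by blin.
by apply: eq_sw => g1 g2; rewrite lactZl lact1E.
Qed.

(** On the right, [cov_lact] carries g past b(h1) and produces b(g1) · (g2 ▷ b(h1)), which the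
    cocycle identity [U_mul] contracts to b(g · h1) with the legs of g redistributed. *)
Lemma twistM (b : H -> B) g h x : inU b ->
  twist t b (g · h) x = twist t b g (twist t b h x).
Proof.
move=> Ub; have lb : slin false b := U_lin Ub; have bt := cov_bilin.
rewrite /twist sw_mul; last by blin.
transitivity (\sw_(h1, h2 <- h) \sw_(g1, r <- g) \sw_(g2, g3 <- r)
   lact (b g1) (lact (g2 ▷ b h1) (t (g3 · h2) x))).
  rewrite sw_exch; apply: eq_sw => h1 h2.
  rewrite -sw_assoc; try by blin.
  apply: eq_sw => p g3; rewrite (U_mul Ub) lact_swl.
  by apply: eq_sw => g1 g2; rewrite lactA.
under [RHS]eq_sw do rewrite cov_sw lact_sw.
rewrite [RHS]sw_exch; apply: eq_sw => h1 h2; apply: eq_sw => g1 r.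
rewrite cov_lact lact_sw.
by apply: eq_sw => g2 g3; rewrite (covM Et).
Qed.

(** Moved to the second argument, the left factor b becomes [conv_inv b]. The antipode reverses the
    legs, so this factor meets the other b on the two middle legs, where they cancel by
    [conv_inv_convl]. *)
Lemma twist_ipA (b : H -> B) g x y : inU b ->
  \sw_(g1, g2 <- g) ipA (twist t b (S g1)^⋆ x) (twist t b g2 y) = g ▷ ipA x y.
Proof.
move=> Ub; have lb : slin false b := U_lin Ub; have bt := cov_bilin.
have lb' := conv_inv_lin lb.
transitivity (\sw_(p, s <- g) \sw_(g1, g2 <- p) \sw_(g3, g4 <- s)
   ipA (t (S g1)^⋆ x) (lact (conv_inv b g2 · b g3) (t g4 y))).
  apply: eq_sw => p s; rewrite /twist sw_star; last by blin.
  rewrite ipA_swl sw_antipode; last by blin.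
  apply: eq_sw => g1 g2; rewrite ipA_sw; apply: eq_sw => g3 g4.
  by rewrite ipA_lact /conv_inv lactA.
rewrite sw_mid; try by blin.
rewrite (cov_ipA Et); apply: eq_sw => g1 r.
transitivity (\sw_(q, g4 <- r)
  ipA (t (S g1)^⋆ x) (lact (conv (conv_inv b) b q) (t g4 y))).
  by apply: eq_sw => q g4; rewrite /conv lact_swl ipA_sw.
rewrite conv_inv_convl //.
rewrite -[RHS](sw_counitl (fun k => ipA (t (S g1)^⋆ x) (t k y))); last by blin.
apply: eq_sw => q g4.
by rewrite /conv_one lactZl lact1E ipA_Zr.
Qed.

(** Stated for every linear b because [twist_transitive] applies it to the transition map in order
    to prove [U_star] for that map. *)
Lemma twist_ipB (b : H -> B) g x y : slin false b ->
  \sw_(g1, g2 <- g) ipB (twist t b g1 x) (twist t b (S g2)^⋆ y)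
  = \sw_(g1, r <- g) \sw_(g2, g3 <- r) (b g1 · (g2 ▷ ipB x y) · conv_inv b g3).
Proof.
move=> lb; have bt := cov_bilin; have lb' := conv_inv_lin lb.
transitivity (\sw_(p, s <- g) \sw_(g1, g2 <- p) \sw_(g3, g4 <- s)
   (b g1 · ipB (t g2 x) (t (S g3)^⋆ y) · conv_inv b g4)).
  apply: eq_sw => p s; rewrite /twist sw_star; last by blin.
  rewrite ipB_swl; apply: eq_sw => g1 g2.
  rewrite ipB_swr sw_antipode; last by blin.
  by apply: eq_sw => g3 g4; rewrite ipB_lactl ipB_lactr amulA.
rewrite sw_mid; try by blin.
apply: eq_sw => g1 r; apply: eq_sw => q g4.
by rewrite (cov_ipB Et) amul_swr amul_swl.
Qed.

Lemma twist_covariant (b : H -> B) : inU b -> covariant (twist t b).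
Proof.
move=> Ub; have lb : slin false b := U_lin Ub; have bt := cov_bilin.
have lb' := conv_inv_lin lb; have [l1 l2] := twist_bilin lb.
split=> [x|g|g h x|x|g x y|g x y].
- exact: l1.
- exact: l2.
- exact: twistM.
- by rewrite /twist sw_one ?(U_one Ub) ?lact1E ?(cov1 Et) //; blin.
- by rewrite twist_ipA.
- rewrite twist_ipB // -sw_assoc; try by blin.
  transitivity (\sw_(p, g3 <- g) \sw_(g1, g2 <- p)
     ((g1 ▷ ipB x y) · b g2 · conv_inv b g3)).
    rewrite sw_assoc; try by blin.
    rewrite -[LHS](sw_counitr (fun k => k ▷ ipB x y)); last by blin.
    (* [U_star] expands the counit of r into b(g2) · [conv_inv b](g3). This puts b to the right of
       g1 ▷ <x, y>, from where [U_comm] moves it to the left. *)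
    apply: eq_sw => g1 r; rewrite -[X in _ *: X]amul1r -amulZr.
    rewrite -[_ *: aone](U_star Ub r) amul_swr.
    by apply: eq_sw => g2 g3; rewrite amulA.
  by apply: eq_sw => p g3; rewrite -!amul_swl (U_comm Ub).
Qed.

End Covariance.

(** * Isomorphisms, and automorphisms as unitary central elements *)

Section Isomorphisms.
Variables (R : realDomainType) (H : hopfStarType R).
Local Notation C := (cplx R).

Lemma bimod_iso_inv (B A : starAlgType R) (E E' : equivBimod B A)
    (f : E -> E') (f' : E' -> E) :
  cancel f f' -> cancel f' f -> bimod_iso f -> bimod_iso f'.
Proof.
move=> fK f'K [fl _ fL fR fB fA]; split.
- by move=> c x y; apply: (can_inj fK); rewrite fl !f'K.
- by exists f.
- by move=> b x; apply: (can_inj fK); rewrite fL !f'K.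
- by move=> x a; apply: (can_inj fK); rewrite fR !f'K.
- by move=> x y; rewrite -fB !f'K.
- by move=> x y; rewrite -fA !f'K.
Qed.

Lemma isomorphic_sym (B A : starAlgType R) (E E' : equivBimod B A) :
  isomorphic E E' -> isomorphic E' E.
Proof.
case=> f ff; have [f' fK f'K] := iso_bij ff.
by exists f'; apply: bimod_iso_inv ff.
Qed.

(* An automorphism is right A-linear, hence, as the inner product with values
   in B is full, given by the action of an element of B. *)
Lemma bimod_auto_central (B : hStarAlgType H) (A : starAlgType R) (E : equivBimod B A)
    (f : E -> E) :
  bimod_iso f -> exists2 c : B, inUZ c & forall x, f x = lact c x.
Proof.
move=> ff; have [s s1] := @ipB_full _ _ _ E aone.
have lf : slin false f := iso_lin ff.
(* Found by applying f to z = sum of k <x, y> z = sum of k x · <y, z>: right linearity gives the sum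
   of k f(x) · <y, z> = k <f x, y> z. *)
pose c : B := \sum_(p <- s) p.1.1 *: ipB (f p.1.2) p.2.
have fE x : f x = lact c x.
  rewrite -[in LHS](lact1E x) s1 !lact_sum (slin_sum _ _ lf).
  apply: eq_bigr => p _; rewrite !lactZl (slin_Z _ _ lf) /=.
  by rewrite !(ip_compat (e := E)) (iso_ract ff).
have cC x : c · x = x · c.
  by apply: (@lact_faithful _ _ _ E) => y; rewrite !lactA -!fE (iso_lact ff).
(* Unitarity expresses that f preserves [ipA]; the other product follows from centrality. *)
have cV : c^⋆ · c = aone.
  apply: (@lact_faithful _ _ _ E) => y; apply: ipA_ext => x.
  by rewrite lactA -ipA_lact -!fE lact1E (iso_ipA ff).
by exists c => //; split=> //; rewrite cC.
Qed.

Variables (B A : hStarAlgType H).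
Implicit Types (F : covBimod B A) (b : Ugroup B).

Lemma cov_isomorphic_sym F F' : cov_isomorphic F F' -> cov_isomorphic F' F.
Proof.
case=> f [ff ft]; have [f' fK f'K] := iso_bij ff.
exists f'; split=> [|g x]; first exact: bimod_iso_inv ff.
by apply: (can_inj fK); rewrite ft !f'K.
Qed.

Lemma cov_isomorphic_trans F1 F2 F3 :
  cov_isomorphic F1 F2 -> cov_isomorphic F2 F3 -> cov_isomorphic F1 F3.
Proof.
case=> f [ff ft] [f' [ff' ft']]; exists (f' \o f).
by split=> [|g x]; [apply: bimod_iso_comp | rewrite /= ft ft'].
Qed.

Lemma PicH_classP F F' : PicH_class F = PicH_class F' <-> cov_isomorphic F F'.
Proof.
split=> [/(congr1 (fun X => sval X F')) /= -> |e]; first exact: cov_isomorphic_refl.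
apply: eq_exist; apply/funext => F0; apply/propext.
split; last exact: cov_isomorphic_trans.
by apply: cov_isomorphic_trans; apply: cov_isomorphic_sym.
Qed.

Lemma Pic_classP (E E' : equivBimod B A) :
  Pic_class E = Pic_class E' <-> isomorphic E E'.
Proof.
split=> [/(congr1 (fun X => sval X E')) /= -> |e]; first exact: isomorphic_refl.
apply: eq_exist; apply/funext => F0; apply/propext.
split; last exact: isomorphic_trans.
by apply: isomorphic_trans; apply: isomorphic_sym.
Qed.

(** * The twist on isomorphism classes: stabilisers and transitivity *)

Definition twist_bimod b F : covBimod B A :=
  CovBimod (twist_covariant (cov_actP F) (UvalP b)).

Lemma twist_bimod_iso b F F' :
  cov_isomorphic F F' -> cov_isomorphic (twist_bimod b F) (twist_bimod b F').
Proof.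
case=> f [ff ft]; exists f; split=> // g x.
have lf : slin false f := iso_lin ff.
rewrite /= /twist (sw_app (L := f) _ _ lf).
by apply: eq_sw => g1 g2; rewrite (iso_lact ff) ft.
Qed.

Lemma twist_bimod1 F : cov_isomorphic (twist_bimod 1%g F) F.
Proof.
exists id; split=> [|g x]; first by split=> //; exists id.
by rewrite /= (twist_one (cov_actP F)).
Qed.

Lemma twist_bimodM b c F :
  cov_isomorphic (twist_bimod (b * c)%g F) (twist_bimod b (twist_bimod c F)).
Proof.
exists id; split=> [|g x]; first by split=> //; exists id.
by rewrite /= (twist_conv (cov_actP F) (@Uval_lin _ _ _ b) (@Uval_lin _ _ _ c)).
Qed.

(** Centrality gives left B-linearity; unitarity gives the inverse c^⋆ and, with centrality for
    [ipB], the two inner products. *)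
Lemma lact_central_iso (E : equivBimod B A) c :
  inUZ c -> bimod_iso (@lact _ _ _ E c).
Proof.
move=> Uc; have Uc' := inUZ_star Uc; split.
- exact: lact_linr (bimoduleP E) c.
- exists (@lact _ _ _ E c^⋆) => x; rewrite -lactA.
    by rewrite (UZ_mulVl Uc) lact1E.
  by rewrite (UZ_mulVr Uc) lact1E.
- by move=> b x; rewrite -!lactA (UZ_central Uc).
- by move=> x a; rewrite (lract (bimoduleP E)).
- move=> x y; rewrite ipB_lactl ipB_lactr.
  by rewrite (UZ_central Uc) -amulA (UZ_mulVl Uc) amul1r.
- by move=> x y; rewrite ipA_lact -lactA (UZ_mulVl Uc) lact1E.
Qed.

(** The action of c is the isomorphism: twisting by [hat c] sends c x to c (g1 ▷ c^⋆) (g2 ▷ c) (g3 .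
    x), and the middle factors form g ▷ (c^⋆ · c), leaving c (g . x). Hence twists depend only on
    classes in [U0]. *)
Lemma twist_hat c (Uc : inUZ c) F :
  cov_isomorphic F (twist_bimod (Uhat Uc) F).
Proof.
exists (@lact _ _ _ F c); split=> [|g x]; first exact: lact_central_iso.
have Et := cov_actP F; have bt := cov_bilin Et; have lh := hat_lin c.
rewrite /= /twist /hat.
transitivity (\sw_(g1, r <- g) lact (c · (g1 ▷ c^⋆)) (\sw_(g2, g3 <- r)
   lact (g2 ▷ c) (cov_act g3 x))); last first.
  by apply: eq_sw => g1 r; rewrite (cov_lact Et).
under [RHS]eq_sw do rewrite lact_sw.
rewrite -sw_assoc; try by blin.
rewrite -(sw_counitl (fun k => lact c (cov_act k x))); last by blin.
apply: eq_sw => p g3.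
transitivity (lact (c · (p ▷ aone)) (cov_act g3 x)).
  by rewrite hact1r amulZr amul1r lactZl.
rewrite -(UZ_mulVl Uc) hact_mul amul_swr lact_swl.
by apply: eq_sw => g1 g2; rewrite -lactA amulA.
Qed.

Lemma twist_free b F :
  cov_isomorphic (twist_bimod b F) F -> U0_eq b 1%g.
Proof.
case=> f [ff ft]; have [c Uc fE] := bimod_auto_central ff.
have Et := cov_actP F; have bt := cov_bilin Et.
have lb : slin false b := @Uval_lin _ _ _ b.
(* Equivariance of f gives this relation only summed against g2 . x; [cov_cancel] removes that
   factor. *)
have e g : c · b g = g ▷ c.
  apply: (@lact_faithful _ _ _ F) => x.
  move: g x; apply: (cov_cancel Et); try by blin.
  move=> g x; rewrite -(cov_lact Et) -fE -ft fE /= /twist lact_sw.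
  by apply: eq_sw => g1 g2; rewrite lactA.
exists c^⋆, (inUZ_star Uc); rewrite mulg1; apply: Uval_inj; apply/funext => g.
by rewrite /= /hat starK -e amulA (UZ_mulVl Uc) amul1l.
Qed.

(* Writing 1 as the sum of the k <x, y>, the transition cocycle from F to F'
   is b g = k <g1 . f x, f (S(g2)^⋆ . y)>. *)
Lemma twist_transitive F F' :
  isomorphic F F' -> exists b, cov_isomorphic (twist_bimod b F) F'.
Proof.
case=> f ff; have [s s1] := @ipB_full _ _ _ F aone.
have [f' fK f'K] := iso_bij ff.
have lf : slin false f := iso_lin ff.
have Et := cov_actP F; have bt := cov_bilin Et.
have Et' := cov_actP F'; have bt' := cov_bilin Et'.
pose b g : B := \sum_(p <- s) p.1.1 *: \sw_(g1, g2 <- g)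
  ipB (cov_act g1 (f p.1.2)) (f (cov_act (S g2)^⋆ p.2)).
have lb : slin false b by rewrite /b; blin.
(* Termwise, writing <u, v> for the inner products of F and F': g . f(u · <v, x>) = (g1 . f u) ·
   <S(g2)^⋆ . v, g3 . x>. As f preserves [ipA], [ip_compat] in F' turns this into <g1 . f u,
   f(S(g2)^⋆ . v)> f(g3 . x). *)
have key g x : \sw_(g1, g2 <- g) lact (b g1) (f (cov_act g2 x))
    = cov_act g (f x).
  rewrite -[in RHS](lact1E x) s1 lact_sum.
  rewrite (slin_sum (f := fun y => cov_act g (f y)) (s := false)); last by blin.
  rewrite /b; under eq_sw do rewrite lact_sum.
  rewrite sw_sum; apply: eq_bigr => p _.
  rewrite lactZl (slin_Z (f := fun y => cov_act g (f y)) (s := false)); last by blin.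
  under eq_sw do rewrite lactZl.
  rewrite -scale_sw; congr (_ *: _).
  rewrite (ip_compat (e := F)) (iso_ract ff) (cov_ract Et').
  under eq_sw do rewrite lact_swl.
  rewrite sw_assoc; try by blin.
  apply: eq_sw => g1 r; rewrite (cov_ipA Et).
  rewrite (sw_app (L := fun a => ract (cov_act g1 (f p.1.2)) a) _ _ (s := false));
    last by blin.
  by apply: eq_sw => g2 g3; rewrite (ip_compat (e := F')) (iso_ipA ff).
have tw g x : f (twist (@cov_act _ _ _ _ F) b g x) = cov_act g (f x).
  rewrite -key /twist (sw_app (L := f) _ _ lf).
  by apply: eq_sw => g1 g2; rewrite (iso_lact ff).
(* Since f is onto, identities between maps H -> B can be tested against f(g2 . x), where [key]
   replaces b by the action on F'. *)
have cancel_f (m n : H -> B) : slin false m -> slin false n ->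
    (forall g x, \sw_(g1, g2 <- g) lact (m g1) (f (cov_act g2 x))
       = \sw_(g1, g2 <- g) lact (n g1) (f (cov_act g2 x))) ->
    forall g, m g = n g.
  move=> lm ln e g; apply: (@lact_faithful _ _ _ F') => y; rewrite -(f'K y).
  apply: (cov_cancel Et (F := fun g x => lact (m g) (f x))
    (G := fun g x => lact (n g) (f x))) => //; by blin.
have Ub : inU b.
  split=> [||g h|g x|g].
  - exact: lb.
  - apply: (@lact_faithful _ _ _ F') => y; rewrite -(f'K y).
    have := key aone (f' y); rewrite sw_one; last by blin.
    by rewrite (cov1 Et) (cov1 Et') lact1E.
  (* Cancelling in g and then in h reduces the cocycle identity to (g · h) . f x = g . (h . f x). *)
  - move: g; apply: cancel_f; try by blin.
    move=> g x; move: h x.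
    apply: (cov_cancel Et); try by blin.
    move=> h x.
    transitivity (cov_act g (cov_act h (f x))).
      rewrite -(covM Et') -key sw_mul; last by blin.
      rewrite sw_exch; apply: eq_sw => h1 h2; apply: eq_sw => g1 g2.
      by rewrite (covM Et).
    rewrite -key (cov_sw Et'); apply: eq_sw => h1 h2.
    rewrite -(iso_lact ff) -key.
    under eq_sw do rewrite (cov_lact Et) (sw_app (L := f) _ _ lf) lact_sw.
    under [RHS]eq_sw do rewrite lact_swl.
    rewrite sw_assoc; try by blin.
    by do 2![apply: eq_sw => ? ?]; rewrite lactA (iso_lact ff).
  (* Tested this way, both sides equal g . (x f(y)): one by [cov_lact] in F', the other by
     [cov_lact] in F. *)
  - move: g; apply: cancel_f; try by blin.
    move=> g y.
    transitivity (cov_act g (lact x (f y))).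
      rewrite (cov_lact Et').
      under [RHS]eq_sw do rewrite -key lact_sw.
      under eq_sw do rewrite lact_swl.
      rewrite sw_assoc; try by blin.
      by do 2![apply: eq_sw => ? ?]; rewrite lactA.
    rewrite -(iso_lact ff) -key.
    under eq_sw do rewrite (cov_lact Et) (sw_app (L := f) _ _ lf) lact_sw.
    under [RHS]eq_sw do rewrite lact_swl.
    rewrite sw_assoc; try by blin.
    by do 2![apply: eq_sw => ? ?]; rewrite lactA (iso_lact ff).
  - have lb' := conv_inv_lin lb.
    (* By [twist_ipB], K gives the transformation of [ipB] under the twisted action. By [tw] that
       action corresponds to the covariant one on F', so K agrees with g ▷ on inner products, hence
       on 1 by fullness; and K 1 is the convolution of b with [conv_inv b]. *)
    pose K d : B :=
      \sw_(g1, r <- g) \sw_(g2, g3 <- r) (b g1 · (g2 ▷ d) · conv_inv b g3).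
    have lK : slin false K by rewrite /K; lin.
    have e : g ▷ aone = K aone.
      rewrite s1 (slin_sum (f := fun d => g ▷ d) (s := false)); last by lin.
      rewrite (slin_sum _ _ lK); apply: eq_bigr => p _.
      rewrite (slin_Z (f := fun d => g ▷ d) (s := false)); last by lin.
      rewrite (slin_Z _ _ lK) /K -(twist_ipB Et) // -(iso_ipB ff).
      rewrite (cov_ipB Et'); congr (_ *: _); apply: eq_sw => g1 g2.
      by rewrite -(iso_ipB ff) !tw.
    rewrite -hact1r e /K; apply: eq_sw => g1 r.
    rewrite -[LHS](sw_counitl (fun k => b g1 · conv_inv b k)); last by blin.
    by apply: eq_sw => g2 g3; rewrite hact1r amulZr amul1r amulZl.
by exists (MkU Ub); exists f; split.
Qed.

End Isomorphisms.

(** * The action of [U0] on [PicH] and the principal bundle *)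

Theorem theorem4p14 (R : realDomainType) (H : hopfStarType R)
    (A B : hStarAlgType H) :
  inhabited (Pic B A) ->
  ~ inhabited (PicH B A) \/
  exists act : U0 B -> PicH B A -> PicH B A,
    (forall (b : Ugroup B) (E : equivBimod B A) (t : H -> E -> E)
        (Et : covariant t),
      exists Ebt : covariant (twist t b),
        act (U0class b) (PicH_class (CovBimod Et)) =
          PicH_class (CovBimod Ebt)) /\
    principal_bundle (@forget R H B A) act.
Proof.
(* If [PicH B A] is empty, every clause of the second alternative is vacuous, so one construction
   serves both cases. *)
move=> _; right.
pose rep (X : PicH B A) : covBimod B A := projT1 (cid (svalP X)).
have repK X : PicH_class (rep X) = X.
  rewrite /rep; case: cid => F /=; case: X => P eP /= e.
  by apply: eq_exist; rewrite e.
pose act (u : U0 B) X := PicH_class (twist_bimod (repr u) (rep X)).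
(* Independence of both chosen representatives: that of b changes by some [Uhat Uc], absorbed by
   [twist_hat], and that of F by an isomorphism, transported by [twist_bimod_iso]. *)
have actE b F : act (U0class b) (PicH_class F) = PicH_class (twist_bimod b F).
  apply/PicH_classP; set b' := repr _; set F' := rep _.
  have /U0classP [c [Uc ->]] : U0class b' = U0class b by apply: U0reprK.
  have FF' : cov_isomorphic F' F by apply/PicH_classP/repK.
  apply: cov_isomorphic_trans (twist_bimod_iso _ FF') _.
  apply: cov_isomorphic_trans (twist_bimodM _ _ _) _.
  exact/cov_isomorphic_sym/twist_hat.
have PicH_ind (P : PicH B A -> Prop) : (forall F, P (PicH_class F)) -> forall X, P X.
  by move=> PF X; rewrite -(repK X); apply: PF.
have U0_ind (P : U0 B -> Prop) : (forall b, P (U0class b)) -> forall u : U0 B, P u.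
  by move=> Pb u; rewrite -(U0reprK u); apply: Pb.
exists act; split=> [b E t Et|].
  by exists (twist_covariant Et (UvalP b)); apply: actE.
split.
- elim/PicH_ind => F; rewrite -[1%g]/(U0class 1%g) actE.
  exact/PicH_classP/twist_bimod1.
- elim/U0_ind => b; elim/U0_ind => c; elim/PicH_ind => F.
  rewrite -[(_ * _)%g]/(U0mul _ _) U0mulE !actE.
  exact/PicH_classP/twist_bimodM.
(* A twist keeps the underlying bimodule, so the two classes coincide by conversion. *)
- by elim/U0_ind => b; elim/PicH_ind => F; rewrite actE !forgetE.
- elim/U0_ind => b; elim/PicH_ind => F; rewrite actE => /PicH_classP e.
  exact/U0classP/(twist_free e).
- elim/PicH_ind => F; elim/PicH_ind => F'; rewrite !forgetE => /Pic_classP.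
  move=> /twist_transitive [b e]; exists (U0class b).
  by rewrite actE; apply/PicH_classP.
Qed.
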